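(* Berwald-type exponential law metrics $$L=\varphi(t,r)\,u^2\exp\left(\frac{v}{u^2}\mu\right)$$ (as defined in the context) are never affinely equivalent to any (pseudo-)Riemannian metric. They always obey $$\dim\mathcal{V}(\mathcal{D}_{\mathcal{H}})=3.$$ That is, they are counterexamples, in the absence of positive definiteness, to the extension of Szabó's metrizability theorem (which states that every positive definite Berwald-Finsler metric, smooth on $TM\setminus\{0\}$, is affinely equivalent to a Riemannian metric).
   Context: $M\subset\mathbb{R}^4\setminus\{0\}$ is open, with spherical coordinates $(x^a)=(t,r,\theta,\phi)$; $(x^a,\dot x^a)$ are the induced coordinates on $TM$, $\partial_a=\partial/\partial x^a$, $\dot\partial_a=\partial/\partial\dot x^a$, $w^2=\dot\theta^2+\dot\phi^2\sin^2\theta$. A conic subbundle is an open $\mathcal{A}\subset TM\setminus0$ projecting onto $M$ and stable under positive rescaling of vectors. A (pseudo-)Finsler function is a smooth $L:\mathcal{A}\to\mathbb{R}$, positively 2-homogeneous in $\dot x$, with nonsingular Hessian $g_{ab}=\frac12\dot\partial_a\dot\partial_bL$ (any signature). It is (pseudo-)Riemannian if $L=a_{ab}(x)\dot x^a\dot x^b$; ''Riemannian'' is used for ''pseudo-Riemannian'' unless positive definiteness is stated. With $G^a=\frac14g^{ab}(\dot x^c\partial_c\dot\partial_bL-\partial_bL)$, $L$ is Berwald if $2G^c=\Gamma^c_{ab}(x)\dot x^a\dot x^b$ for a torsion-free affine connection $\nabla$ on $M$ (its canonical connection). Two Berwald metrics are affinely equivalent if they have the same canonical connection (for a pseudo-Riemannian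 metric this is the Levi-Civita connection). $\delta_a=\partial_a-\Gamma^c_{ab}\dot x^b\dot\partial_c$; $\mathcal{D}_{\mathcal{H}}=\mathrm{Span}\{\delta_a,[\delta_a,\delta_b],[\delta_a,[\delta_b,\delta_c]],\dots\}=\mathrm{Span}\{\delta_a\}\oplus\mathcal{V}(\mathcal{D}_{\mathcal{H}})$ on $\mathcal{A}$, where $\mathcal{V}(\mathcal{D}_{\mathcal{H}})\subset\mathrm{Span}\{\dot\partial_a\}$ is the vertical part; dimension means fibre dimension. $L$ is spatially spherically symmetric if $L=L(t,r,\dot t,\dot r,w)$ (invariance under $SO(3)$ rotations fixing $t$). Its canonical connection has the coefficients, with $k_i=k_i(t,r)$: $\Gamma^t_{tt}=k_1$, $\Gamma^t_{tr}=k_2$, $\Gamma^t_{rr}=k_3$, $\Gamma^r_{tt}=k_4$, $\Gamma^r_{rr}=k_5$, $\Gamma^r_{tr}=k_6$, $\Gamma^t_{\theta\theta}=\Gamma^t_{\phi\phi}/\sin^2\theta=k_7$, $\Gamma^\phi_{\phi t}=\Gamma^\theta_{\theta t}=k_8$, $\Gamma^\phi_{\phi r}=\Gamma^\theta_{\theta r}=k_9$, $\Gamma^r_{\theta\theta}=\Gamma^r_{\phi\phi}/\sin^2\theta=k_{10}$, $\Gamma^\theta_{\phi\phi}=-\sin\theta\cos\theta$, $\Gamma^\phi_{\theta\phi}=\cot\theta$, the remaining ones (up to lower-index symmetry) being zero. Curvature functions (commas are partial derivatives): $a_1=k_{1,r}-k_{2,t}+k_3k_4-k_2k_6$, $a_2=k_{2,r}-k_{3,t}+k_2^2+k_3k_6-k_1k_3-k_2k_5$,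 $a_3=k_{4,r}-k_{6,t}+k_1k_6+k_4k_5-k_2k_4-k_6^2$, $a_4=k_{6,r}-k_{5,t}+k_2k_6-k_3k_4$, $a_5=k_{8,r}-k_{9,t}$, $a_6=-k_{7,t}+k_7k_8-k_1k_7-k_2k_{10}$, $a_7=-k_{10,t}+k_8k_{10}-k_4k_7-k_6k_{10}$, $a_8=-k_{8,t}+k_1k_8+k_4k_9-k_8^2$, $a_9=-k_{9,t}+k_2k_8+k_6k_9-k_8k_9$, $a_{10}=-k_{7,r}+k_7k_9-k_2k_7-k_3k_{10}$, $a_{11}=-k_{10,r}+k_9k_{10}-k_6k_7-k_5k_{10}$, $a_{12}=-k_{8,r}+k_2k_8+k_6k_9-k_8k_9$, $a_{13}=-k_{9,r}+k_3k_8+k_5k_9-k_9^2$. Exponential law Berwald metric (Class 2): a spatially spherically symmetric Berwald metric whose canonical connection has $k_7,\dots,k_{10}$ not all zero, with $k_{10}\neq0$ (the paper's convention); one puts $a=k_7/k_{10}$, $b=k_8/k_{10}$, $c=(k_9k_{10}-k_7k_8)/k_{10}^2$. The connection satisfies that $[\delta_t,[\delta_t,\delta_r]]$ and $[\delta_r,[\delta_t,\delta_r]]$ are proportional to $[\delta_t,\delta_r]$, and $b(aa_1+a_2)+(ab+c)(aa_3+a_4)-a_5(2ab+c)=0$, $a(aa_3+a_4)-(aa_1+a_2)=0$, $(ab+c)a_3+b(aa_3+a_4)+b(a_1-2a_5)=0$, $a_6=aa_7$, $a_8=ba_7$, $a_9=(ab+c)a_7$, $a_{10}=aa_{11}$,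 $a_{12}=ba_{11}$, $a_{13}=(ab+c)a_{11}$. With $D=aa_3-a_1+a_5$, $E=ba_3$, $F=aa_3-a_1$, $G=2(k_1-k_4a)$, $H=2(k_2-k_6a)$, it is required that $D=0$, $E\neq0$, $F\neq0$, and $L$ is given by the displayed exponential formula with $u=\dot t-a\dot r$, $v=c\dot r^2+2b\dot t\dot r-w^2$, $\mu=F/E$ and $\varphi(t,r)=\exp\left(\int(G+2k_4b\mu)\,dt+(H+2k_6b\mu)\,dr\right)$ (integral along an arbitrary path in the $(t,r)$ plane from some $(t_0,r_0)$ to $(t,r)$). *)

(* Defs.v *)
(* R : realType stands for the real numbers. *)
From HB Require Import structures.
From mathcomp Require Import all_boot all_order all_algebra.
From mathcomp Require Import all_classical all_reals all_analysis.
Set Implicit Arguments.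
Unset Strict Implicit.
Unset Printing Implicit Defensive.
Import Order.TTheory GRing.Theory Num.Theory.
Import numFieldNormedType.Exports.
Local Open Scope classical_set_scope.
Local Open Scope ring_scope.

(* A point x of M is its coordinate row (x^0, x^1, x^2, x^3) = (t, r, theta,
   phi); a point of TM is the pair of x and the fibre coordinates of a vector. *)
Notation Pt R := 'rV[R]_4.
Notation TPt R := ('rV[R]_4 * 'rV[R]_4)%type.

Definition it : 'I_4 := @Ordinal 4 0 isT.
Definition ir : 'I_4 := @Ordinal 4 1 isT.
Definition ith : 'I_4 := @Ordinal 4 2 isT.
Definition iph : 'I_4 := @Ordinal 4 3 isT.

Section Smoothness.
Context {R : realType}.

Fixpoint Ck (V : normedModType R) (n : nat) (A : set V) (f : V -> R) : Prop :=
  match n with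
  | 0 => forall p, A p -> {for p, continuous f}
  | m.+1 => (forall p, A p -> differentiable f p) /\
            (forall v, Ck m A ('D_v f))
  end.

Definition smooth_on (V : normedModType R) (A : set V) (f : V -> R) : Prop :=
  forall n, Ck n A f.

End Smoothness.

Section Finsler.
Context {R : realType}.
Implicit Types (M : set (Pt R)) (A : set (TPt R)) (L : TPt R -> R).

Definition e_ (a : 'I_4) : Pt R := delta_mx 0 a.

Definition dx (a : 'I_4) (f : TPt R -> R) : TPt R -> R := 'D_(e_ a, 0) f.
Definition dv (a : 'I_4) (f : TPt R -> R) : TPt R -> R := 'D_(0, e_ a) f.

(* M in coordinates: a nonempty open set on which (t, r, theta, phi) are local
   spherical coordinates of R^4 minus the origin. The range of the azimuth phi
   is left free, which covers every choice of an interval of length 2 pi. *)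
Definition spherical_domain M : Prop :=
  [/\ open M, M !=set0 &
      forall x, M x -> 0 < x 0 ir /\ 0 < x 0 ith < pi].

Definition conic_subbundle M A : Prop :=
  [/\ open A,
      forall p, A p -> M p.1 /\ p.2 != 0,
      forall x, M x -> exists y, A (x, y) &
      forall x y (l : R), 0 < l -> A (x, y) -> A (x, l *: y)].

Definition hess L (p : TPt R) : 'M[R]_4 :=
  \matrix_(a, b) (2^-1 * dv a (dv b L) p).

Definition finsler M A L : Prop :=
  [/\ conic_subbundle M A,
      smooth_on A L,
      forall x y (l : R), 0 < l -> A (x, y) -> L (x, l *: y) = l ^+ 2 * L (x, y) &
      forall p, A p -> hess L p \in unitmx].

Definition spray L (a : 'I_4) (p : TPt R) : R :=
  4^-1 * \sum_b invmx (hess L p) a b *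
    (\sum_c p.2 0 c * dx c (dv b L) p - dx b L p).

(* G c a b x is Gamma^c_{ab}(x). *)
Definition connection := 'I_4 -> 'I_4 -> 'I_4 -> Pt R -> R.
Implicit Type G : connection.

Definition torsion_free_connection M G : Prop :=
  (forall c a b, smooth_on M (G c a b)) /\
  (forall c a b x, M x -> G c a b x = G c b a x).

Definition canonical_connection M A L G : Prop :=
  [/\ finsler M A L, torsion_free_connection M G &
      forall p, A p -> forall c,
        2 * spray L c p = \sum_a \sum_b G c a b p.1 * p.2 0 a * p.2 0 b].

Definition berwald M A L : Prop := exists G, canonical_connection M A L G.

Definition pseudo_riemannian M A L : Prop :=
  finsler M A L /\
  exists g : Pt R -> 'M[R]_4, forall p, A p ->
    L p = \sum_a \sum_b g p.1 a b * p.2 0 a * p.2 0 b.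

Definition affinely_equivalent M A L A' L' : Prop :=
  exists G, canonical_connection M A L G /\ canonical_connection M A' L' G.

(* The Finsler functions on M are allowed to live on different conic
   subbundles: affine equivalence only compares connections on M. *)
Definition metrizable M A L : Prop :=
  exists A' L', pseudo_riemannian M A' L' /\ affinely_equivalent M A L A' L'.

(* What the extension of Szabo's theorem to Berwald metrics of arbitrary
   signature, on arbitrary conic subbundles, asserts of L. *)
Definition szabo_extension_at M A L : Prop :=
  berwald M A L -> metrizable M A L.

(* Components of a tangent vector of TM: horizontal (along the d/dx^a), then
   vertical (along the d/d xdot^a). *)
Definition vfield := TPt R -> TPt R.

Definition lie (X Y : vfield) : vfield :=
  fun p => 'D_(X p) Y p - 'D_(Y p) X p.

Definition delta G (a : 'I_4) : vfield := fun p =>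
  (e_ a, - \row_c \sum_b G c a b p.1 * p.2 0 b).

Inductive iterated_bracket G : vfield -> Prop :=
| Bracket0 a : iterated_bracket G (delta G a)
| BracketS a X : iterated_bracket G X -> iterated_bracket G (lie (delta G a) X).

(* Fibre at p of the distribution D_H. *)
Definition D_H G (p : TPt R) : set (TPt R) :=
  [set Z | exists n (c : 'I_n -> R) (X : 'I_n -> vfield),
     (forall i, iterated_bracket G (X i)) /\ Z = \sum_i c i *: X i p].

(* Fibre at p of V(D_H), in the basis (d/d xdot^a). *)
Definition vert_D_H G (p : TPt R) : set (Pt R) := [set z | D_H G p (0, z)].

Definition has_dim (S : set (Pt R)) (d : nat) : Prop :=
  exists W : {vspace (Pt R)}, S = [set z | z \in W] /\ \dim W = d.

End Finsler.
Arguments connection : clear implicits.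
Arguments vfield : clear implicits.

Section Spherical.
Context {R : realType}.
Implicit Types (M : set (Pt R)) (A : set (TPt R)) (L : TPt R -> R).

Definition wdot (p : TPt R) : R :=
  Num.sqrt (p.2 0 ith ^+ 2 + p.2 0 iph ^+ 2 * sin (p.1 0 ith) ^+ 2).

Definition spherically_symmetric A L : Prop :=
  exists l : R -> R -> R -> R -> R -> R, forall p, A p ->
    L p = l (p.1 0 it) (p.1 0 ir) (p.2 0 it) (p.2 0 ir) (wdot p).

Definition fun2 := R -> R -> R.

Definition d_t (f : fun2) : fun2 := fun t r => derive1 (fun s => f s r) t.
Definition d_r (f : fun2) : fun2 := fun t r => derive1 (fun s => f t s) r.

(* The functions k_1, ..., k_10 of (t, r) are k 1, ..., k 10; other indices are
   not used. *)
Definition sph_connection (k : nat -> fun2) : connection R := fun c a b x =>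
  let t := x 0 it in let r := x 0 ir in let th := x 0 ith in
  match val c, val a, val b with
  | 0, 0, 0 => k 1 t r
  | 0, 0, 1 | 0, 1, 0 => k 2 t r
  | 0, 1, 1 => k 3 t r
  | 1, 0, 0 => k 4 t r
  | 1, 1, 1 => k 5 t r
  | 1, 0, 1 | 1, 1, 0 => k 6 t r
  | 0, 2, 2 => k 7 t r
  | 0, 3, 3 => (k 7%N t r * sin th ^+ 2)%R
  | 3, 3, 0 | 3, 0, 3 | 2, 2, 0 | 2, 0, 2 => k 8 t r
  | 3, 3, 1 | 3, 1, 3 | 2, 2, 1 | 2, 1, 2 => k 9 t r
  | 1, 2, 2 => k 10 t r
  | 1, 3, 3 => (k 10%N t r * sin th ^+ 2)%R
  | 2, 3, 3 => (- (sin th * cos th))%R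
  | 3, 2, 3 | 3, 3, 2 => (cos th / sin th)%R
  | _, _, _ => 0%R
  end%N.

Section CurvatureFunctions.
Variables (k : nat -> fun2) (t r : R).
Local Notation K i := (k i%N t r).
Local Notation Kt i := (d_t (k i%N) t r).
Local Notation Kr i := (d_r (k i%N) t r).

Definition a1 := Kr 1 - Kt 2 + K 3 * K 4 - K 2 * K 6.
Definition a2 := Kr 2 - Kt 3 + K 2 ^+ 2 + K 3 * K 6 - K 1 * K 3 - K 2 * K 5.
Definition a3 := Kr 4 - Kt 6 + K 1 * K 6 + K 4 * K 5 - K 2 * K 4 - K 6 ^+ 2.
Definition a4 := Kr 6 - Kt 5 + K 2 * K 6 - K 3 * K 4.
Definition a5 := Kr 8 - Kt 9.
Definition a6 := - Kt 7 + K 7 * K 8 - K 1 * K 7 - K 2 * K 10.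
Definition a7 := - Kt 10 + K 8 * K 10 - K 4 * K 7 - K 6 * K 10.
Definition a8 := - Kt 8 + K 1 * K 8 + K 4 * K 9 - K 8 ^+ 2.
Definition a9 := - Kt 9 + K 2 * K 8 + K 6 * K 9 - K 8 * K 9.
Definition a10 := - Kr 7 + K 7 * K 9 - K 2 * K 7 - K 3 * K 10.
Definition a11 := - Kr 10 + K 9 * K 10 - K 6 * K 7 - K 5 * K 10.
Definition a12 := - Kr 8 + K 2 * K 8 + K 6 * K 9 - K 8 * K 9.
Definition a13 := - Kr 9 + K 3 * K 8 + K 5 * K 9 - K 9 ^+ 2.

Definition fa := K 7 / K 10.
Definition fb := K 8 / K 10.
Definition fc := (K 9 * K 10 - K 7 * K 8) / K 10 ^+ 2.

Definition fD := fa * a3 - a1 + a5.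
Definition fE := fb * a3.
Definition fF := fa * a3 - a1.
Definition fG := 2 * (K 1 - K 4 * fa).
Definition fH := 2 * (K 2 - K 6 * fa).
Definition mu := fF / fE.

Definition class2_relations : Prop :=
  [/\ fb * (fa * a1 + a2) + (fa * fb + fc) * (fa * a3 + a4)
        - a5 * (2 * fa * fb + fc) = 0,
      fa * (fa * a3 + a4) - (fa * a1 + a2) = 0 &
      (fa * fb + fc) * a3 + fb * (fa * a3 + a4) + fb * (a1 - 2 * a5) = 0]
  /\ [/\ a6 = fa * a7, a8 = fb * a7 & a9 = (fa * fb + fc) * a7]
  /\ [/\ a10 = fa * a11, a12 = fb * a11 & a13 = (fa * fb + fc) * a11].

End CurvatureFunctions.

Definition tr_proj M : set (R * R) :=
  [set q | exists x, M x /\ q = (x 0 it, x 0 ir)].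

(* g is a C^1 path in P from q0 to q1, parametrized by [0, 1]; a C^1 path on
   [0, 1] extends to R, so g is taken C^1 on R. *)
Definition C1_path (P : set (R * R)) (q0 q1 : R * R) (g1 g2 : R -> R) : Prop :=
  [/\ forall s, derivable g1 s 1 /\ derivable g2 s 1,
      continuous (derive1 g1) /\ continuous (derive1 g2),
      forall s, 0 <= s <= 1 -> P (g1 s, g2 s),
      (g1 0, g2 0) = q0 & (g1 1, g2 1) = q1].

Definition line_integral (f h : fun2) (g1 g2 : R -> R) : R :=
  \int[lebesgue_measure]_(s in `[0, 1])
    (f (g1 s) (g2 s) * derive1 g1 s + h (g1 s) (g2 s) * derive1 g2 s).

Definition is_phi M (k : nat -> fun2) (phi : fun2) : Prop :=
  let f t r := fG k t r + 2 * k 4%N t r * fb k t r * mu k t r in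
  let h t r := fH k t r + 2 * k 6%N t r * fb k t r * mu k t r in
  exists q0, tr_proj M q0 /\
    forall q1 g1 g2, C1_path (tr_proj M) q0 q1 g1 g2 ->
      phi q1.1 q1.2 = expR (line_integral f h g1 g2).

Definition udot (k : nat -> fun2) (p : TPt R) : R :=
  p.2 0 it - fa k (p.1 0 it) (p.1 0 ir) * p.2 0 ir.

Definition vquad (k : nat -> fun2) (p : TPt R) : R :=
  fc k (p.1 0 it) (p.1 0 ir) * p.2 0 ir ^+ 2
  + 2 * fb k (p.1 0 it) (p.1 0 ir) * p.2 0 it * p.2 0 ir - wdot p ^+ 2.

Definition proportional_on A (X Y : vfield R) : Prop :=
  forall p, A p -> exists l : R, X p = l *: Y p.

(* k_10 <> 0 at every point subsumes that k_7, ..., k_10 are not all zero. The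
   exponential formula only makes sense where u <> 0, hence ExpU (in Rocq,
   division by 0 is total). *)
Record exponential_law_berwald M A L (k : nat -> fun2) (phi : fun2) : Prop := {
  ExpSym : spherically_symmetric A L;
  ExpConn : canonical_connection M A L (sph_connection k);
  ExpK10 : forall t r, tr_proj M (t, r) -> k 10%N t r != 0;
  ExpPropT :
    let d := delta (sph_connection k) in
    proportional_on A (lie (d it) (lie (d it) (d ir))) (lie (d it) (d ir));
  ExpPropR :
    let d := delta (sph_connection k) in
    proportional_on A (lie (d ir) (lie (d it) (d ir))) (lie (d it) (d ir));
  ExpRel : forall t r, tr_proj M (t, r) -> class2_relations k t r;
  ExpDEF : forall t r, tr_proj M (t, r) ->
    [/\ fD k t r = 0, fE k t r != 0 & fF k t r != 0];
  ExpPhi : is_phi M k phi;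
  ExpU : forall p, A p -> udot k p != 0;
  ExpL : forall p, A p ->
    L p = phi (p.1 0 it) (p.1 0 ir) * udot k p ^+ 2 *
          expR (vquad k p / udot k p ^+ 2 * mu k (p.1 0 it) (p.1 0 ir))
}.

End Spherical.
Arguments fun2 : clear implicits.

(* Main.v *)
(* Write F = a a_3 - a_1, nu = a_3 / F, u = dt - a dr and X = a d_t + d_r. The
   Class 2 relations force c = -2ab, that is k_7 = a k_10, k_8 = b k_10 and
   k_9 = - a b k_10; the curvature then consists of the linear vertical fields
     [delta_t, delta_r] = - F Z, with Z = id - nu u X,
     [delta_t, delta_theta] = a_7 N_theta,  [delta_r, delta_theta] = a_11 N_theta,
   the same two with N_phi for phi, and [delta_theta, delta_phi] = - Rot, where
   N_theta = dtheta X + b u d_theta, N_phi = sin^2 theta dphi X + b u d_phi and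
   Rot is the infinitesimal rotation. By a_5 = a_9 - a_12 (the first Bianchi
   identity), F = b (a a_7 + a_11), so a_7 and a_11 never vanish together.

   Covariant derivatives of N_theta, N_phi and Rot are combinations of these
   three fields, and Z is parallel: along t and r this is exactly what the two
   proportionality hypotheses say. Hence every iterated bracket is a combination
   of Z, N_theta, N_phi, Rot with smooth coefficients. Where u <> 0 the first
   three are independent and Rot is a combination of N_theta and N_phi, whence
   the dimension 3.

   A pseudo-Riemannian metric with the same connection is parallel (uniqueness
   of the Levi-Civita connection), hence, by Schwarz's theorem, every curvature
   operator is skew for it. Skewness of - F Z puts d_theta in its kernel, which
   contradicts nondegeneracy. *)
Require Import Defs.
From mathcomp Require Import all_boot all_order all_algebra.
From mathcomp Require Import all_classical all_reals all_analysis.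
From mathcomp Require Import ring lra.
Set Implicit Arguments.
Unset Strict Implicit.
Unset Printing Implicit Defensive.
Import Order.TTheory GRing.Theory Num.Theory.
Import numFieldNormedType.Exports.
Local Open Scope classical_set_scope.
Local Open Scope ring_scope.

(** * Directional derivatives *)

Section Derivatives.
Context {R : realType} {V : normedModType R}.
Implicit Types (x v : V) (f g : V -> R).

Lemma is_derive_const (W : normedModType R) (c : W) x v : is_derive x v (fun=> c) 0.
Proof. exact: is_derive_cst. Qed.

Lemma is_derive_mul f g x v df dg :
  is_derive x v f df -> is_derive x v g dg ->
  is_derive x v (fun z => f z * g z) (df * g x + f x * dg).
Proof.
move=> hf hg; apply: (is_derive_eq (is_deriveM hf hg)).
by rewrite addrC /GRing.scale /= [g x * _]mulrC.
Qed.

Lemma is_derive_add f g x v df dg :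
  is_derive x v f df -> is_derive x v g dg ->
  is_derive x v (fun z => f z + g z) (df + dg).
Proof. exact: is_deriveD. Qed.

Lemma is_derive_opp f x v df :
  is_derive x v f df -> is_derive x v (fun z => - f z) (- df).
Proof. exact: is_deriveN. Qed.

Lemma is_derive_inv f x v df : f x != 0 ->
  is_derive x v f df -> is_derive x v (fun z => (f z)^-1) (- df * (f x)^-1 * (f x)^-1).
Proof.
move=> f0 hf; split; first exact: derivableV.
rewrite (deriveV f0) // derive_val /GRing.scale /= expr2 invfM.
by ring.
Qed.

Lemma is_derive_sumr n (h : 'I_n -> V -> R) x v (dh : 'I_n -> R) :
  (forall i, is_derive x v (h i) (dh i)) ->
  is_derive x v (fun z => \sum_(i < n) h i z) (\sum_(i < n) dh i).
Proof. by move=> hh; rewrite -fct_sumE; exact: is_derive_sum. Qed.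

Lemma is_derive_mx m n (F : V -> 'M[R]_(m, n)) x v (dF : 'M[R]_(m, n)) :
  (forall i j, is_derive x v (fun z => F z i j) (dF i j)) -> is_derive x v F dF.
Proof.
move=> hF; have dvF : derivable F x v by apply/derivable_mxP => i j; exact: ex_derive.
by split=> //; rewrite derive_mx //; apply/matrixP => i j; rewrite mxE derive_val.
Qed.

Lemma is_derive_coord m n x v (F : V -> 'M[R]_(m, n)) dF i j :
  is_derive x v F dF -> is_derive x v (fun z => F z i j) (dF i j).
Proof.
move=> [hF <-]; split; first by move/derivable_mxP: hF.
by rewrite derive_mx // mxE.
Qed.

Lemma is_derive_pair (W1 W2 : normedModType R) (f : V -> W1) (g : V -> W2) x v df dg :
  is_derive x v f df -> is_derive x v g dg ->
  is_derive x v (fun z => (f z, g z)) (df, dg).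
Proof.
move=> [hf ef] [hg eg].
have c : (fun h : R => h^-1 *: (((fun z => (f z, g z)) \o shift x) (h *: v) - (f x, g x)))
    @ 0^' --> (df, dg).
  rewrite -ef -eg => S nS.
  exact: (@cvg_pair _ _ _ _ _ _ _ _ _
    (fun h : R => h^-1 *: ((f \o shift x) (h *: v) - f x))
    (fun h : R => h^-1 *: ((g \o shift x) (h *: v) - g x)) hf hg S nS).
split; first by apply/cvg_ex; exists (df, dg); exact: c.
by apply: cvg_lim => //; exact: c.
Qed.

End Derivatives.

Section DerivativesProd.
Context {R : realType} {V W U : normedModType R}.

Lemma is_derive_fst (f : V -> U) (p : V * W) v w df :
  is_derive p.1 v f df -> is_derive p (v, w) (fun q => f q.1) df.
Proof. by case=> h1 h2; split. Qed.

Lemma is_derive_snd (f : W -> U) (p : V * W) v w df :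
  is_derive p.2 w f df -> is_derive p (v, w) (fun q => f q.2) df.
Proof. by case=> h1 h2; split. Qed.

Lemma is_derive_open_eq (A : set V) (f g : V -> U) x v df :
  open A -> A x -> (forall y, A y -> f y = g y) ->
  is_derive x v f df -> is_derive x v g df.
Proof.
move=> oA Ax fg; apply: near_eq_is_derive.
by apply: filterS (open_nbhs_nbhs (conj oA Ax)) => y /fg.
Qed.

Lemma derive_open_eq (A : set V) (f g : V -> U) x v :
  open A -> A x -> (forall y, A y -> f y = g y) -> 'D_v f x = 'D_v g x.
Proof.
move=> oA Ax fg; apply: near_eq_derive.
by apply: filterS (open_nbhs_nbhs (conj oA Ax)) => y /fg.
Qed.

End DerivativesProd.

(** Along [e_ a] the coordinate [z 0 b] moves with speed 1 or 0, so the difference quotient is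
    either the one-variable one or constantly zero. *)
Lemma is_derive_along (R : realType) (f : R -> R) (x : Pt R) (a b : 'I_4) df :
  is_derive (x 0 b) 1 f df ->
  is_derive x (e_ a) (fun z => f (z 0 b)) (if a == b then df else 0).
Proof.
move=> [h1 h2].
pose g (h : R) := h^-1 *: (f (h * (a == b)%:R + x 0 b) - f (x 0 b)).
have gE : (fun h : R => h^-1 *: (((fun z : Pt R => f (z 0 b)) \o shift x) (h *: e_ a)
    - f (x 0 b))) = g.
  by apply/funext => h; rewrite /g /= !mxE eqxx /= [b == a]eq_sym.
rewrite /derivable /derive; split; rewrite ?/derivable ?/derive gE /g;
  case: eqP => _ //.
- under eq_fun do rewrite mulr0 add0r subrr scaler0.
  exact: is_cvg_cst.
- under eq_fun do rewrite mulr0 add0r subrr scaler0.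
  exact: lim_cst.
Qed.

(** * Functions with iterated partial derivatives of every order *)

Section SmoothFunctions.
Context {R : realType} (M : set (Pt R)) (oM : open M).
Implicit Types (x : Pt R) (f g : Pt R -> R) (n : nat).

(* Only iterated partial derivatives matter below, so neither continuity nor
   Frechet differentiability is recorded. *)
Fixpoint pdiff n f : Prop :=
  match n with
  | 0 => True
  | m.+1 => (forall x a, M x -> derivable f x (e_ a)) /\
            (forall a, pdiff m ('D_(e_ a) f))
  end.

Definition pdsmooth f := forall n, pdiff n f.

Lemma pdiff_ext n f g : (forall x, M x -> f x = g x) -> pdiff n f -> pdiff n g.
Proof.
elim: n f g => //= n IH f g fg [df Df]; split=> [x a Mx|a].
  have /derivableP dfx := df x a Mx.
  by case: (is_derive_open_eq oM Mx fg dfx).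
apply: IH (Df a) => x Mx; exact: derive_open_eq oM Mx fg.
Qed.

Lemma pdiff_le n f : pdiff n.+1 f -> pdiff n f.
Proof.
elim: n f => //= n IH f [df Df]; split=> // a; apply: IH; exact: Df.
Qed.

Lemma pdiff_cst n (c : R) : pdiff n (fun=> c).
Proof.
elim: n c => //= n IH c; split=> [x a _|a]; first exact: derivable_cst.
by apply: pdiff_ext (IH 0) => x _; case: (is_derive_const c x (e_ a)).
Qed.

Lemma pdiffD n f g : pdiff n f -> pdiff n g -> pdiff n (fun x => f x + g x).
Proof.
elim: n f g => //= n IH f g [df Df] [dg Dg]; split=> [x a Mx|a].
  by case: (is_derive_add (derivableP (df x a Mx)) (derivableP (dg x a Mx))).
apply: pdiff_ext (IH _ _ (Df a) (Dg a)) => x Mx.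
by case: (is_derive_add (derivableP (df x a Mx)) (derivableP (dg x a Mx))).
Qed.

(** The Leibniz rule pairs a derivative of one factor with the other factor itself, which [pdiff_le]
    brings down to the same order. *)
Lemma pdiffM n f g : pdiff n f -> pdiff n g -> pdiff n (fun x => f x * g x).
Proof.
elim: n f g => // n IH f g hf hg; have [lf lg] := (pdiff_le hf, pdiff_le hg).
case: hf hg => [df Df] [dg Dg]; split=> [x a Mx|a].
  by case: (is_derive_mul (derivableP (df x a Mx)) (derivableP (dg x a Mx))).
apply: pdiff_ext (pdiffD (IH _ _ (Df a) lg) (IH _ _ lf (Dg a))) => x Mx.
by case: (is_derive_mul (derivableP (df x a Mx)) (derivableP (dg x a Mx))).
Qed.

Lemma pdiffN n f : pdiff n f -> pdiff n (fun x => - f x).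
Proof.
move=> hf; apply: pdiff_ext (pdiffM (pdiff_cst n (-1)) hf) => x _; exact: mulN1r.
Qed.

(** The derivative [- f' * f^-1 * f^-1] is a product of functions already known to have one order
    less, so the product rule closes the induction. *)
Lemma pdiffV n f : (forall x, M x -> f x != 0) ->
  pdiff n f -> pdiff n (fun x => (f x)^-1).
Proof.
move=> f0; elim: n => // n IH hf; have /IH lf := pdiff_le hf.
case: hf => df Df; have dV x a Mx := is_derive_inv (f0 x Mx) (derivableP (df x a Mx)).
split=> [x a Mx|a]; first by case: (dV x a Mx).
apply: pdiff_ext (pdiffM (pdiffM (pdiffN (Df a)) lf) lf) => x Mx.
by case: (dV x a Mx).
Qed.

Lemma pdsmooth_derive a f : pdsmooth f -> pdsmooth ('D_(e_ a) f).
Proof. by move=> hf n; have [_] := hf n.+1; exact. Qed.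

Lemma pdsmooth_is_derive x a f : pdsmooth f -> M x -> is_derive x (e_ a) f ('D_(e_ a) f x).
Proof. by move=> hf Mx; have [/(_ x a Mx)/derivableP] := hf 1%N. Qed.

Lemma pdsmooth_ext f g : (forall x, M x -> f x = g x) -> pdsmooth f -> pdsmooth g.
Proof. by move=> fg hf n; exact: pdiff_ext fg (hf n). Qed.

Lemma pdsmooth_cst c : pdsmooth (fun=> c).
Proof. by move=> n; exact: pdiff_cst. Qed.

Lemma pdsmoothD f g : pdsmooth f -> pdsmooth g -> pdsmooth (fun x => f x + g x).
Proof. by move=> hf hg n; exact: pdiffD. Qed.

Lemma pdsmoothN f : pdsmooth f -> pdsmooth (fun x => - f x).
Proof. by move=> hf n; exact: pdiffN. Qed.

Lemma pdsmoothM f g : pdsmooth f -> pdsmooth g -> pdsmooth (fun x => f x * g x).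
Proof. by move=> hf hg n; exact: pdiffM. Qed.

Lemma pdsmoothV f : (forall x, M x -> f x != 0) -> pdsmooth f -> pdsmooth (fun x => (f x)^-1).
Proof. by move=> f0 hf n; exact: pdiffV. Qed.

Lemma pdsmooth_sum m (h : 'I_m -> Pt R -> R) :
  (forall i, pdsmooth (h i)) -> pdsmooth (fun x => \sum_(i < m) h i x).
Proof.
elim: m h => [|m IH] h hh.
  by apply: pdsmooth_ext (pdsmooth_cst 0) => x _; rewrite big_ord0.
apply: pdsmooth_ext (pdsmoothD (IH _ (fun i => hh (widen_ord (leqnSn m) i))) (hh ord_max)).
by move=> x _; rewrite big_ord_recr.
Qed.

Lemma smooth_on_pdsmooth f : smooth_on M f -> pdsmooth f.
Proof.
move=> hf n; have := hf n; elim: n f {hf} => //= n IH f [df Df]; split=> [x a Mx|a].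
  by apply: diff_derivable; exact: df.
exact: IH (Df _).
Qed.

End SmoothFunctions.

(** * Linear vertical fields *)

Section LinearVerticalFields.
Context {R : realType}.
Implicit Types (G : connection R) (x y : Pt R) (B : Pt R -> 'M[R]_4).

(** Fibre vectors are rows: the row index is the lower index contracted with the fibre coordinate,
    the column index the upper one, so that the vertical part of [delta G a] is
    [- y *m conn_mx G a x]. *)
Definition conn_mx G (a : 'I_4) x : 'M[R]_4 := \matrix_(b, c) G c a b x.

Definition pd_mx (a : 'I_4) B x : 'M[R]_4 :=
  \matrix_(i, j) 'D_(e_ a) (fun z => B z i j) x.

Definition linv B : vfield R := fun p => (0, p.2 *m B p.1).

(** The covariant derivative of a field of endomorphisms, in the row convention. It is the Lie
    bracket with [delta G a] on linear vertical fields ([lie_delta_linv]). *)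
Definition nabla G a B x : 'M[R]_4 :=
  pd_mx a B x - conn_mx G a x *m B x + B x *m conn_mx G a x.

(** The curvature operator, with the sign that makes it the bracket of [delta G a] and [delta G b]
    ([lie_delta_delta]). *)
Definition curv G a b x : 'M[R]_4 :=
  pd_mx b (conn_mx G a) x - pd_mx a (conn_mx G b) x
  + conn_mx G a x *m conn_mx G b x - conn_mx G b x *m conn_mx G a x.

Lemma conn_mxE G a b c : (fun x => conn_mx G a x b c) = G c a b.
Proof. by apply/funext => x; rewrite mxE. Qed.

Lemma deltaE G a : delta G a = fun p => (e_ a, - (p.2 *m conn_mx G a p.1)).
Proof.
apply/funext => p; congr (_, - _); apply/rowP => c; rewrite !mxE.
by apply: eq_bigr => b _; rewrite !mxE mulrC.
Qed.

Lemma is_derive_linear_fibre B (p : TPt R) v w (dB : 'M[R]_4) :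
  (forall i j, is_derive p.1 v (fun z => B z i j) (dB i j)) ->
  is_derive p (v, w) (fun q => q.2 *m B q.1) (w *m B p.1 + p.2 *m dB).
Proof.
move=> hB; apply: is_derive_mx => i j.
under eq_fun do rewrite mxE.
rewrite !mxE -big_split; apply: is_derive_sumr => k.
apply: is_derive_mul; last exact: is_derive_fst.
apply: (@is_derive_snd R (Pt R) (Pt R) _ (fun z => z i k)).
by apply: (@is_derive_coord _ _ _ _ _ _ id); exact: is_derive_id.
Qed.

Lemma is_derive_delta G a (p : TPt R) v w (dG : 'M[R]_4) :
  (forall i j, is_derive p.1 v (fun z => G j a i z) (dG i j)) ->
  is_derive p (v, w) (delta G a) (0, - (w *m conn_mx G a p.1 + p.2 *m dG)).
Proof.
move=> hG; rewrite deltaE; apply: is_derive_pair.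
apply: (@is_deriveN R (TPt R) (Pt R) (fun q => q.2 *m conn_mx G a q.1)).
by apply: is_derive_linear_fibre => i j; rewrite conn_mxE.
Qed.

Lemma lie_delta_linv G a B (p : TPt R) :
  (forall i j, derivable (fun z => B z i j) p.1 (e_ a)) ->
  lie (delta G a) (linv B) p = linv (nabla G a B) p.
Proof.
move=> hB; rewrite /lie {1}deltaE.
have h1 : is_derive p (e_ a, - (p.2 *m conn_mx G a p.1)) (linv B)
    (0, - (p.2 *m conn_mx G a p.1) *m B p.1 + p.2 *m pd_mx a B p.1).
  apply: is_derive_pair.
  by apply: is_derive_linear_fibre => i j; rewrite mxE; exact: derivableP.
have h2 : is_derive p (0, p.2 *m B p.1) (delta G a)
    (0, - (p.2 *m B p.1 *m conn_mx G a p.1 + p.2 *m 0)).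
  by apply: is_derive_delta => i j; rewrite mxE; exact: is_derive0.
rewrite (derive_val (is_derive := h1)) (derive_val (is_derive := h2)) /linv /nabla.
congr (_, _) => /=; first exact: subr0.
rewrite mulmx0 addr0 opprK -!mulmxA mulNmx -mulmxA mulmxDr mulmxBr.
by rewrite [_ + p.2 *m pd_mx _ _ _]addrC.
Qed.

Lemma lie_delta_delta G a b (p : TPt R) :
  (forall c i, derivable (G c a i) p.1 (e_ b)) ->
  (forall c i, derivable (G c b i) p.1 (e_ a)) ->
  lie (delta G a) (delta G b) p = linv (curv G a b) p.
Proof.
move=> ha hb; have e c : delta G c p = (e_ c, - (p.2 *m conn_mx G c p.1)) by rewrite deltaE.
rewrite /lie !e.
have h1 : is_derive p (e_ a, - (p.2 *m conn_mx G a p.1)) (delta G b)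
    (0, - (- (p.2 *m conn_mx G a p.1) *m conn_mx G b p.1 + p.2 *m pd_mx a (conn_mx G b) p.1)).
  apply: is_derive_delta => i j; rewrite mxE conn_mxE; exact: derivableP.
have h2 : is_derive p (e_ b, - (p.2 *m conn_mx G b p.1)) (delta G a)
    (0, - (- (p.2 *m conn_mx G b p.1) *m conn_mx G a p.1 + p.2 *m pd_mx b (conn_mx G a) p.1)).
  apply: is_derive_delta => i j; rewrite mxE conn_mxE; exact: derivableP.
rewrite (derive_val (is_derive := h1)) (derive_val (is_derive := h2)) /linv /curv.
congr (_, _) => /=; first exact: subr0.
rewrite mulmxBr mulmxDr mulmxBr !mulmxA !mulNmx.
set u := _ *m _ *m _; set v := _ *m pd_mx _ _ _; set w := _ *m _ *m _; set z := _ *m pd_mx _ _ _.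
by apply/matrixP => i j; move: u v w z => u v w z; rewrite !mxE; ring.
Qed.

Lemma is_derive_scale_mx (f : Pt R -> R) B x v df (dB : 'M[R]_4) i j :
  is_derive x v f df -> is_derive x v (fun z => B z i j) (dB i j) ->
  is_derive x v (fun z => (f z *: B z) i j) ((df *: B x + f x *: dB) i j).
Proof.
by move=> hf hB; under eq_fun do rewrite mxE; rewrite !mxE; exact: is_derive_mul.
Qed.

Lemma nabla_scale G a (f : Pt R -> R) B x : derivable f x (e_ a) ->
  (forall i j, derivable (fun z => B z i j) x (e_ a)) ->
  nabla G a (fun z => f z *: B z) x = 'D_(e_ a) f x *: B x + f x *: nabla G a B x.
Proof.
move=> hf hB; rewrite /nabla.
have -> : pd_mx a (fun z => f z *: B z) x = 'D_(e_ a) f x *: B x + f x *: pd_mx a B x.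
  apply/matrixP => i j; rewrite mxE.
  have h : is_derive x (e_ a) (fun z => B z i j) (pd_mx a B x i j).
    by rewrite mxE; exact: derivableP.
  by rewrite (derive_val (is_derive := is_derive_scale_mx (derivableP hf) h)).
by rewrite -scalemxAr -scalemxAl scalerDr scalerBr !addrA.
Qed.

Lemma nabla_sum G a n (B : 'I_n -> Pt R -> 'M[R]_4) x :
  (forall m i j, derivable (fun z => B m z i j) x (e_ a)) ->
  nabla G a (fun z => \sum_m B m z) x = \sum_m nabla G a (B m) x.
Proof.
move=> hB; rewrite /nabla.
have -> : pd_mx a (fun z => \sum_m B m z) x = \sum_m pd_mx a (B m) x.
  apply/matrixP => i j; rewrite mxE summxE; under eq_fun do rewrite summxE.
  under [RHS]eq_bigr do rewrite mxE.
  have h m := derivableP (hB m i j).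
  by rewrite (derive_val (is_derive := is_derive_sumr h)).
by rewrite !big_split /= sumrN mulmx_suml mulmx_sumr.
Qed.

End LinearVerticalFields.

(** * Algebra of the invariant frame *)

Lemma sum4 (V : nmodType) (f : 'I_4 -> V) :
  \sum_(i < 4) f i = f it + f ir + f ith + f iph.
Proof.
rewrite !big_ord_recl big_ord0 addr0 !addrA.
by congr (f _ + f _ + f _ + f _); apply/val_inj.
Qed.

Section FrameAlgebra.
Context {R : realType}.
Implicit Types (K dK : nat -> R) (e i m n : nat).

(** Entries indexed by [nat] let tables given by pattern matching compute once the indices are split
    into cases. *)
Definition mx4 (f : nat -> nat -> R) : 'M[R]_4 := \matrix_(i, j) f i j.

Lemma mul_mx4 f g : mx4 f *m mx4 g =
  mx4 (fun i j => f i 0%N * g 0%N j + f i 1%N * g 1%N j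
                  + f i 2%N * g 2%N j + f i 3%N * g 3%N j).
Proof.
by apply/matrixP => i j; rewrite !mxE sum4 !mxE.
Qed.

(* [q] stands for [sin theta ^+ 2] and [w] for [cot theta]; [m] is the lower
   index carried by the fibre coordinate, [n] the upper one. *)
Definition gam e K q w m n : R :=
  match e, m, n with
  | 0, 0, 0 => K 1 | 0, 1, 0 => K 2 | 0, 0, 1 => K 4 | 0, 1, 1 => K 6
  | 0, 2, 2 | 0, 3, 3 => K 8
  | 1, 0, 0 => K 2 | 1, 1, 0 => K 3 | 1, 0, 1 => K 6 | 1, 1, 1 => K 5
  | 1, 2, 2 | 1, 3, 3 => K 9
  | 2, 2, 0 => K 7 | 2, 2, 1 => K 10 | 2, 0, 2 => K 8 | 2, 1, 2 => K 9
  | 2, 3, 3 => w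
  | 3, 3, 0 => (K 7%N * q)%R | 3, 3, 1 => (K 10%N * q)%R
  | 3, 0, 3 => K 8 | 3, 1, 3 => K 9
  | 3, 3, 2 => (- (w * q))%R | 3, 2, 3 => w
  | _, _, _ => 0%R
  end%N.

(** An entry of [gam] that is a single [K i] or [w] is differentiated by substituting the
    derivative, so the table is reused; only the products with [q] need the Leibniz rule. *)
Definition dgam e K q w dK dq dw m n : R :=
  match e, m, n with
  | 3, 3, 0 => (dK 7%N * q + K 7%N * dq)%R
  | 3, 3, 1 => (dK 10%N * q + K 10%N * dq)%R
  | 3, 3, 2 => (- (dw * q + w * dq))%R
  | _, _, _ => gam e dK q dw m n
  end%N.

(* With X = (a, 1, 0, 0) and u = dt - a dr, the frame consists of
   id - nu u X, dtheta X + b u d_theta, q dphi X + b u d_phi and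
   q dphi d_theta - dtheta d_phi. *)
Definition frame i (a b nu q : R) m n : R :=
  match i, m, n with
  | 0, 0, 0 => (1 - nu * a)%R | 0, 0, 1 => (- nu)%R
  | 0, 1, 0 => (nu * (a * a))%R | 0, 1, 1 => (1 + nu * a)%R
  | 0, 2, 2 | 0, 3, 3 => 1%R
  | 1, 2, 0 => a | 1, 2, 1 => 1%R | 1, 0, 2 => b | 1, 1, 2 => (- (a * b))%R
  | 2, 3, 0 => (q * a)%R | 2, 3, 1 => q | 2, 0, 3 => b | 2, 1, 3 => (- (a * b))%R
  | 3, 3, 2 => q | 3, 2, 3 => (-1)%R
  | _, _, _ => 0%R
  end%N.

Definition dframe i (a b nu q da db dnu dq : R) m n : R :=
  match i, m, n with
  | 0, 0, 0 => (- (dnu * a + nu * da))%R | 0, 0, 1 => (- dnu)%R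
  | 0, 1, 0 => (dnu * (a * a) + nu * (da * a + a * da))%R
  | 0, 1, 1 => (dnu * a + nu * da)%R
  | 1, 2, 0 => da | 1, 0, 2 => db | 1, 1, 2 => (- (da * b + a * db))%R
  | 2, 3, 0 => (dq * a + q * da)%R | 2, 3, 1 => dq
  | 2, 0, 3 => db | 2, 1, 3 => (- (da * b + a * db))%R
  | 3, 3, 2 => dq
  | _, _, _ => 0%R
  end%N.

(* The matrix of [u X]. *)
Definition null_mx (a : R) m n : R :=
  match m, n with
  | 0, 0 => a | 0, 1 => 1%R | 1, 0 => (- (a * a))%R | 1, 1 => (- a)%R
  | _, _ => 0%R
  end%N.

(** Connection coefficients of the frame: the covariant derivative along [e] of the field [i] has
    component [lam e K a q w i j] on the field [j]. All entries with [i = 0] vanish because [Z] is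
    parallel. *)
Definition lam e K (a q w : R) i j : R :=
  match e, i, j with
  | 0, 1, 1 | 0, 2, 2 => (a * K 4%N + K 6%N - K 8%N)%R
  | 1, 1, 1 | 1, 2, 2 => (a * K 6%N + K 5%N - K 9%N)%R
  | 2, 2, 2 => w | 2, 3, 2 => K 10 | 2, 3, 3 => w
  | 3, 1, 2 => w | 3, 2, 1 => (- (w * q))%R | 3, 3, 1 => (- (K 10%N * q))%R
  | _, _, _ => 0%R
  end%N.

(** The formula of [nabla] applied to a frame field, with the derivatives of [a], [b], [nu] and [q]
    left as free values. *)
Definition cov_frame e i K a b nu q w da db dnu dq : 'M[R]_4 :=
  mx4 (dframe i a b nu q da db dnu dq)
  - mx4 (gam e K q w) *m mx4 (frame i a b nu q)
  + mx4 (frame i a b nu q) *m mx4 (gam e K q w).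

Definition frame_mx i a b nu q := mx4 (frame i a b nu q).

Definition dir_val (x y z : R) (e : nat) : R :=
  match e with 0 => x | 1 => y | 2 => z | _ => 0 end.

(** The values that the derivatives of [a], [b] and [nu] will turn out to have. The first says that
    covariant differentiation along t and r preserves the line spanned by [X]. Those of [a] and [b]
    follow from the Class 2 relations, that of [nu] from the two proportionality hypotheses. *)
Definition frame_da K a := dir_val
  (- (a * K 1%N) - K 2%N + a * a * K 4%N + a * K 6%N)
  (- (a * K 2%N) - K 3%N + a * a * K 6%N + a * K 5%N) 0.

Definition frame_db K b := dir_val
  (b * (K 1%N + K 6%N - 2 * K 8%N)) (b * (K 2%N + K 5%N - 2 * K 9%N)) 0.

Definition frame_dnu K a nu := dir_val
  (nu * (K 1%N - 2 * a * K 4%N - K 6%N)) (nu * (K 2%N - 2 * a * K 6%N - K 5%N)) 0.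

Section Covariant.
Variables (K : nat -> R) (a b nu q w : R).
Hypotheses (K7 : K 7%N = a * K 10%N) (K8 : K 8%N = b * K 10%N)
  (K9 : K 9%N = - (a * b * K 10%N)).

Local Notation da := (frame_da K a).
Local Notation db := (frame_db K b).
Local Notation dnu := (frame_dnu K a nu).
Local Notation dq := (dir_val 0 0 (2 * w * q)).

(** In [Z = id - nu u X] the identity is parallel and [u X] is recurrent, with a factor that matches
    [frame_dnu]. The derivative [dnu'] of [nu] stays free, since it is determined later from this
    very formula. *)
Lemma cov_frame_scaling e dnu' : (e < 4)%N ->
  cov_frame e 0 K a b nu q w (da e) (db e) dnu' (dq e) =
  (dnu e - dnu') *: mx4 (null_mx a).
Proof.
move=> e4; rewrite /cov_frame !mul_mx4; apply/matrixP => i j; rewrite !mxE.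
case: e e4 => [|[|[|[|]]]] // _;
  case: i => [[|[|[|[|]]]] hi] //; case: j => [[|[|[|[|]]]] hj] //;
  rewrite /= ?K7 ?K8 ?K9; ring.
Qed.

Lemma cov_frameE e (i : 'I_4) : (e < 4)%N ->
  cov_frame e i K a b nu q w (da e) (db e) (dnu e) (dq e) =
  \sum_(j < 4) lam e K a q w i j *: frame_mx j a b nu q.
Proof.
move=> e4; rewrite /cov_frame !mul_mx4 sum4 /frame_mx.
apply/matrixP => m n; rewrite !mxE.
case: i => [[|[|[|[|]]]] hi] //; case: e e4 => [|[|[|[|]]]] // _;
  case: m => [[|[|[|[|]]]] hm] //; case: n => [[|[|[|[|]]]] hn] //;
  rewrite /= ?K7 ?K8 ?K9; ring.
Qed.

End Covariant.
End FrameAlgebra.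

(** * Curvature of the Class 2 connections in the frame *)

Section CurvatureAlgebra.
Context {R : realType}.
Implicit Types (K : nat -> R) (e : nat).

(* The relations [a_i = ...] of the Class 2 metrics solved for derivatives,
   with [nu F] in place of [a_3], and [F = b (a a_7 + a_11)]. *)
Definition fdF (a b f7 f11 : R) : R := b * (a * f7 + f11).

Record frame_data K (Kt Kr : nat -> R) (a b nu f7 f11 : R) : Prop := FrameData {
  fd_K7 : K 7%N = a * K 10%N;
  fd_K8 : K 8%N = b * K 10%N;
  fd_K9 : K 9%N = - (a * b * K 10%N);
  fd_K10 : K 10%N != 0;
  fd_b : b != 0;
  fd_F : fdF a b f7 f11 != 0;
  fd_r1 : Kr 1%N = Kt 2%N - K 3%N * K 4%N + K 2%N * K 6%N + (a * nu - 1) * fdF a b f7 f11;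
  fd_r2 : Kr 2%N = Kt 3%N - K 2%N ^+ 2 - K 3%N * K 6%N + K 1%N * K 3%N
                   + K 2%N * K 5%N - a ^+ 2 * nu * fdF a b f7 f11;
  fd_r4 : Kr 4%N = Kt 6%N - K 1%N * K 6%N - K 4%N * K 5%N + K 2%N * K 4%N
                   + K 6%N ^+ 2 + nu * fdF a b f7 f11;
  fd_r6 : Kr 6%N = Kt 5%N - K 2%N * K 6%N + K 3%N * K 4%N - (a * nu + 1) * fdF a b f7 f11;
  fd_t7 : Kt 7%N = K 7%N * K 8%N - K 1%N * K 7%N - K 2%N * K 10%N - a * f7;
  fd_t10 : Kt 10%N = K 8%N * K 10%N - K 4%N * K 7%N - K 6%N * K 10%N - f7;
  fd_t8 : Kt 8%N = K 1%N * K 8%N + K 4%N * K 9%N - K 8%N ^+ 2 - b * f7;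
  fd_t9 : Kt 9%N = K 2%N * K 8%N + K 6%N * K 9%N - K 8%N * K 9%N + a * b * f7;
  fd_r7 : Kr 7%N = K 7%N * K 9%N - K 2%N * K 7%N - K 3%N * K 10%N - a * f11;
  fd_r10 : Kr 10%N = K 9%N * K 10%N - K 6%N * K 7%N - K 5%N * K 10%N - f11;
  fd_r8 : Kr 8%N = K 2%N * K 8%N + K 6%N * K 9%N - K 8%N * K 9%N - b * f11;
  fd_r9 : Kr 9%N = K 3%N * K 8%N + K 5%N * K 9%N - K 9%N ^+ 2 + a * b * f11
}.

Section Relations.
Variables (k : nat -> fun2 R) (t r : R).
Local Notation K i := (k i%N t r).

Hypotheses (K10 : K 10 != 0) (hrel : class2_relations k t r)
  (hD : fD k t r = 0) (hE : fE k t r != 0) (hF : fF k t r != 0).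

Lemma class2_frame_data :
  frame_data (fun i => k i t r) (fun i => d_t (k i) t r) (fun i => d_r (k i) t r)
    (fa k t r) (fb k t r) (a3 k t r / fF k t r) (a7 k t r) (a11 k t r).
Proof.
have [b0 a30] : fb k t r != 0 /\ a3 k t r != 0.
  by move: hE; rewrite /fE mulf_eq0 negb_or => /andP.
case: hrel => -[e1 e2 e3] [[e6 e8 e9] [e10 e12 e13]].
set a := fa k t r in e1 e2 e3 e6 e8 e9 e10 e12 e13 *.
set b := fb k t r in b0 e1 e2 e3 e6 e8 e9 e10 e12 e13 *.
set c := fc k t r in e1 e3 e9 e13.
have h7 : K 7 = a * K 10 by rewrite /a /fa; field.
have h8 : K 8 = b * K 10 by rewrite /b /fb; field.
have h9 : K 9 = (a * b + c) * K 10 by rewrite /a /b /c /fa /fb /fc; field.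
have e5 : a5 k t r = a9 k t r - a12 k t r by rewrite /a5 /a9 /a12; ring.
set F := fF k t r; have F0 : F != 0 := hF.
have f1 : a1 k t r = a * a3 k t r - F by rewrite /F /fF -/a; ring.
have f5 : a5 k t r = - F by move: hD; rewrite /fD -/a f1 => h; lra.
(* With the second relation and [a5 = - F], the first one factors as [(2ab + c)(a a3 + a4 + F) = 0].
   If the second factor vanishes, the third relation leaves [(2ab + c) a3 = 0], and [a3] is nonzero
   because [E = b a3] is. *)
have hc : c = - (2 * a * b).
  have p1 : (2 * a * b + c) * (a * a3 k t r + a4 k t r + F) = 0.
    rewrite -e1 f5; have -> : a * a1 k t r + a2 k t r = a * (a * a3 k t r + a4 k t r).
      by apply/esym/eqP; rewrite -subr_eq0 e2.
    by ring.
  have p2 : b * (a * a3 k t r + a4 k t r + F) = - ((2 * a * b + c) * a3 k t r).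
    by move: e3; rewrite f5 f1 => h; lra.
  move/eqP: p1; rewrite mulf_eq0 => /orP[/eqP h|/eqP h]; first by lra.
  move/esym/eqP: p2; rewrite h mulr0 oppr_eq0 mulf_eq0 (negbTE a30) orbF => /eqP h'.
  by lra.
have f4 : a4 k t r = - (a * a3 k t r) - F.
  have : b * (a4 k t r + a * a3 k t r + F) = 0.
    by move: e3; rewrite f5 f1 hc => h; lra.
  by move/eqP; rewrite mulf_eq0 (negbTE b0) => /eqP h; lra.
have f2 : a2 k t r = - (a ^+ 2 * a3 k t r) by move: e2; rewrite f1 f4 => h; lra.
have hF' : F = b * (a * a7 k t r + a11 k t r).
  by move: f5; rewrite e5 e9 e12 hc => h; lra.
have nuF : a3 k t r / F * F = a3 k t r by rewrite divfK.
set nu := a3 k t r / F in nuF *.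
have h9' : K 9 = - (a * b * K 10) by rewrite h9 hc; ring.
rewrite hc in e9 e13.
have s1 : (a * nu - 1) * F = a * a3 k t r - F by rewrite -nuF; ring.
have s2 : a ^+ 2 * nu * F = a ^+ 2 * a3 k t r by rewrite -nuF; ring.
have s4 : (a * nu + 1) * F = a * a3 k t r + F by rewrite -nuF; ring.
split => //; rewrite /fdF -?hF' ?s1 ?s2 ?nuF ?s4 //.
- by move: f1; rewrite {1}/a1 => h; lra.
- by move: f2; rewrite {1}/a2 => h; lra.
- by rewrite /a3; ring.
- by move: f4; rewrite {1}/a4 => h; lra.
- by move: e6; rewrite {1}/a6 => h; lra.
- by rewrite /a7; ring.
- by move: e8; rewrite {1}/a8 => h; lra.
- by move: e9; rewrite {1}/a9 => h; lra.
- by move: e10; rewrite {1}/a10 => h; lra.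
- by rewrite /a11; ring.
- by move: e12; rewrite {1}/a12 => h; lra.
- by move: e13; rewrite {1}/a13 => h; lra.
Qed.

End Relations.

(** Components of the curvature in the frame: the bracket of the horizontal fields [e] and [e'] has
    coefficient [kap F f7 f11 e e' j] on the field [j]. *)
Definition kap (F f7 f11 : R) (e e' j : nat) : R :=
  match e, e', j with
  | 0, 1, 0 => - F | 1, 0, 0 => F
  | 0, 2, 1 | 0, 3, 2 => f7 | 2, 0, 1 | 3, 0, 2 => - f7
  | 1, 2, 1 | 1, 3, 2 => f11 | 2, 1, 1 | 3, 1, 2 => - f11
  | 2, 3, 3 => -1 | 3, 2, 3 => 1
  | _, _, _ => 0
  end.

Section FrameData.
Variables (K Kt Kr : nat -> R) (a b nu f7 f11 q w : R).
Hypothesis fd : frame_data K Kt Kr a b nu f7 f11.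

Local Notation dK e := (fun i => dir_val (Kt i) (Kr i) 0 e).
Local Notation dq := (dir_val 0 0 (2 * w * q)).
Local Notation dw := (dir_val 0 0 (- 1 - w ^+ 2)).

(** The derivatives of [q] and [w] are polynomials in [q] and [w], as those of the squared sine and
    of the cotangent. After elimination of the derivatives fixed by [frame_data], the remaining ones
    cancel and each entry is a polynomial identity. *)
Lemma curv_frame (e e' : nat) : (e < 4)%N -> (e' < 4)%N ->
  mx4 (dgam e K q w (dK e') (dq e') (dw e'))
  - mx4 (dgam e' K q w (dK e) (dq e) (dw e))
  + mx4 (gam e K q w) *m mx4 (gam e' K q w)
  - mx4 (gam e' K q w) *m mx4 (gam e K q w)
  = \sum_(j < 4) kap (fdF a b f7 f11) f7 f11 e e' j *: frame_mx j a b nu q.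
Proof.
case: fd => h7 h8 h9 _ _ _ r1 r2 r4 r6 t7 t10 t8 t9 r7 r10 r8 r9 e4 e'4.
rewrite !mul_mx4 sum4 /frame_mx.
apply/matrixP => m n; rewrite !mxE.
case: e e4 => [|[|[|[|]]]] // _; case: e' e'4 => [|[|[|[|]]]] // _;
  case: m => [[|[|[|[|]]]] hm] //; case: n => [[|[|[|[|]]]] hn] //;
  rewrite /= ?r1 ?r2 ?r4 ?r6 ?t7 ?t10 ?t8 ?t9 ?r7 ?r10 ?r8 ?r9 ?h7 ?h8 ?h9 /fdF; ring.
Qed.

(** The left-hand side is the quotient rule for [a = K 7 / K 10]. *)
Lemma frame_data_da e :
  (dK e 7%N * K 10%N - K 7%N * dK e 10%N) / K 10%N ^+ 2 = frame_da K a e.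
Proof.
case: fd => h7 h8 h9 h10 _ _ _ _ _ _ t7 t10 t8 t9 r7 r10 r8 r9.
rewrite t7 t10 r7 r10 h7 h8 h9 /frame_da.
by case: e => [|[|[|e]]] /=; field; exact: h10.
Qed.

Lemma frame_data_db e :
  (dK e 8%N * K 10%N - K 8%N * dK e 10%N) / K 10%N ^+ 2 = frame_db K b e.
Proof.
case: fd => h7 h8 h9 h10 _ _ _ _ _ _ t7 t10 t8 t9 r7 r10 r8 r9.
rewrite t8 t10 r8 r10 /frame_db h7 h8 h9.
by case: e => [|[|[|e]]] /=; field; exact: h10.
Qed.

End FrameData.
End CurvatureAlgebra.

(** * The connection in spherical coordinates *)

Section Coordinates.
Context {R : realType}.
Implicit Types (x : Pt R) (f : fun2 R).

(** Both sides are the limit of one and the same difference quotient. *)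
Lemma derive_t f x : 'D_(e_ it) (fun z : Pt R => f (z 0 it) (z 0 ir)) x = d_t f (x 0 it) (x 0 ir).
Proof.
rewrite /derive /d_t derive1E /derive.
set g := (fun h : R => _); suff -> : g = fun h : R =>
    h^-1 *: (((fun s => f s (x 0 ir)) \o shift (x 0 it)) (h *: 1) - f (x 0 it) (x 0 ir)) by [].
by apply/funext => h; rewrite /g /= !mxE /= mulr0 add0r.
Qed.

Lemma derive_r f x : 'D_(e_ ir) (fun z : Pt R => f (z 0 it) (z 0 ir)) x = d_r f (x 0 it) (x 0 ir).
Proof.
rewrite /derive /d_r derive1E /derive.
set g := (fun h : R => _); suff -> : g = fun h : R =>
    h^-1 *: (((fun s => f (x 0 it) s) \o shift (x 0 ir)) (h *: 1) - f (x 0 it) (x 0 ir)) by [].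
by apply/funext => h; rewrite /g /= !mxE /= mulr0 add0r.
Qed.

Lemma is_derive_angle f x (e : 'I_4) : (1 < e)%N ->
  is_derive x (e_ e) (fun z : Pt R => f (z 0 it) (z 0 ir)) 0.
Proof.
move=> e1.
have gE : (fun h : R => h^-1 *: (((fun z : Pt R => f (z 0 it) (z 0 ir)) \o shift x) (h *: e_ e)
    - f (x 0 it) (x 0 ir))) = fun=> 0.
  apply/funext => h; rewrite /= !mxE.
  have -> : (it == e) = false by apply/eqP => E; rewrite -E in e1.
  have -> : (ir == e) = false by apply/eqP => E; rewrite -E in e1.
  by rewrite /= mulr0 !add0r subrr scaler0.
split; first by rewrite /derivable gE; exact: is_cvg_cst.
by rewrite /derive gE; exact: lim_cst.
Qed.

Definition qf x : R := sin (x 0 ith) ^+ 2.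
Definition wf x : R := cos (x 0 ith) / sin (x 0 ith).

Lemma is_derive_qf x (e : 'I_4) : sin (x 0 ith) != 0 ->
  is_derive x (e_ e) qf (dir_val 0 0 (2 * wf x * qf x) e).
Proof.
move=> s0; have h := is_derive_along e (is_derive_sin (x 0 ith)).
apply: is_derive_eq (is_derive_mul h h) _; rewrite /wf /qf.
by case: e {h} => [[|[|[|[|]]]] he] //=; field.
Qed.

Lemma is_derive_wf x (e : 'I_4) : sin (x 0 ith) != 0 ->
  is_derive x (e_ e) wf (dir_val 0 0 (- 1 - wf x ^+ 2) e).
Proof.
move=> s0; have hs := is_derive_along e (is_derive_sin (x 0 ith)).
have hc := is_derive_along e (is_derive_cos (x 0 ith)).
have hi := @is_derive_inv _ _ (fun z : Pt R => sin (z 0 ith)) _ _ _ s0 hs.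
apply: is_derive_eq (is_derive_mul hc hi) _; rewrite /wf.
by case: e {hs hc hi} => [[|[|[|[|]]]] he] //=; field.
Qed.

Lemma is_derive_gam x v (K : Pt R -> nat -> R) (q w : Pt R -> R) dK dq dw e m n :
  (forall i, (0 < i <= 10)%N -> is_derive x v (fun z => K z i) (dK i)) ->
  is_derive x v q dq -> is_derive x v w dw ->
  is_derive x v (fun z => gam e (K z) (q z) (w z) m n)
    (dgam e (K x) (q x) (w x) dK dq dw m n).
Proof.
move=> hK hq hw; have h0 := is_derive_const (0 : R) x v.
have hM i : (0 < i <= 10)%N ->
    is_derive x v (fun z => K z i * q z) (dK i * q x + K x i * dq).
  by move=> hi; apply: is_derive_mul => //; exact: hK.
have hW := is_derive_opp (is_derive_mul hw hq).
case: e => [|[|[|[|e]]]]; case: m => [|[|[|[|m]]]] //=; case: n => [|[|[|[|n]]]] //=;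
  try exact: h0; try exact: hw; try exact: hW; try exact: hK; exact: hM.
Qed.

Lemma is_derive_frame x v (a b nu q : Pt R -> R) da db dnu dq i m n :
  is_derive x v a da -> is_derive x v b db -> is_derive x v nu dnu -> is_derive x v q dq ->
  is_derive x v (fun z => frame i (a z) (b z) (nu z) (q z) m n)
    (dframe i (a x) (b x) (nu x) (q x) da db dnu dq m n).
Proof.
move=> ha hb hnu hq; have h0 := is_derive_const (0 : R) x v.
have h1 := is_derive_const (1 : R) x v; have h1' := is_derive_const (-1 : R) x v.
have hna := is_derive_mul hnu ha; have hab := is_derive_opp (is_derive_mul ha hb).
have hqa := is_derive_mul hq ha; have hnaa := is_derive_mul hnu (is_derive_mul ha ha).
have hm := is_derive_opp hna; have hn := is_derive_opp hnu.
case: i => [|[|[|[|i]]]]; case: m => [|[|[|[|m]]]] //=; case: n => [|[|[|[|n]]]] //=;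
  try exact: h0; try exact: h1; try exact: h1'; try exact: hq; try exact: ha; try exact: hb;
  try exact: hab; try exact: hqa; try exact: hnaa; try exact: hn.
- by apply: is_derive_eq (is_derive_add h1 hm) _; rewrite add0r.
- by apply: is_derive_eq (is_derive_add h1 hna) _; rewrite add0r.
Qed.

(** The sine has to be nonzero for [- sin * cos] to equal [- (w * q)], where [w] is a quotient by
    the sine. *)
Lemma conn_mx_gam (k : nat -> fun2 R) (e : 'I_4) x : sin (x 0 ith) != 0 ->
  conn_mx (sph_connection k) e x =
  mx4 (gam e (fun i => k i (x 0 it) (x 0 ir)) (qf x) (wf x)).
Proof.
move=> s0; apply/matrixP => m n; rewrite !mxE /sph_connection /qf /wf.
by case: e => [[|[|[|[|]]]] he] //; case: m => [[|[|[|[|]]]] hm] //;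
  case: n => [[|[|[|[|]]]] hn] //=; field.
Qed.

End Coordinates.

(** * Schwarz's theorem *)

Section Schwarz.
Context {R : realType} {V : normedModType R}.
Implicit Types (f g : V -> R) (v w p q : V).

Lemma is_derive_line g v q (c : R) : derivable g (c *: v + q) v ->
  is_derive c 1 (fun h : R => g (h *: v + q)) ('D_v g (c *: v + q)).
Proof.
move=> dg.
have E : (fun h : R => h^-1 *: (((fun h : R => g (h *: v + q)) \o shift c) (h *: 1)
    - g (c *: v + q))) =
    (fun h : R => h^-1 *: ((g \o shift (c *: v + q)) (h *: v) - g (c *: v + q))).
  by apply/funext => h; rewrite /= scalerDl -addrA [h%:A]mulr1.
by split; [rewrite /derivable E | rewrite /derive E].
Qed.

Lemma MVT_line g v q (h : R) : 0 < h ->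
  (forall c, 0 <= c <= h -> derivable g (c *: v + q) v) ->
  exists2 c, 0 <= c <= h & g (h *: v + q) - g q = h * 'D_v g (c *: v + q).
Proof.
move=> h0 dg.
pose F (c : R) : R := g (c *: v + q); pose dF (c : R) : R := 'D_v g (c *: v + q).
have dl (c : R) : c \in `[0, h]%R -> is_derive c 1 F (dF c).
  by rewrite in_itv /= => hc; exact: is_derive_line (dg c hc).
have dl' (c : R) : c \in `]0, h[%R -> is_derive c 1 F (dF c).
  by move=> hc; apply: dl; exact: subset_itv_oo_cc hc.
have cF : {within `[0, h], continuous F}.
  by apply: derivable_within_continuous => c hc; case: (dl c hc).
have [c + E] := MVT h0 dl' cF.
rewrite in_itv /= => /andP[c0 ch]; exists c; first by rewrite !ltW.
have -> : g q = F 0 by rewrite /F scale0r add0r.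
by rewrite [LHS]E subr0 mulrC.
Qed.

Lemma nbhs_parallelogram (B : set V) v w p : nbhs p B ->
  exists2 h : R, 0 < h & forall s t, 0 <= s <= h -> 0 <= t <= h -> B (s *: v + (t *: w + p)).
Proof.
(* The summand 1 keeps [d] positive when [v] and [w] both vanish. *)
move=> /nbhs_normP [r /= r0 hB]; pose d := `|v| + `|w| + 1.
have d0 : 0 < d by rewrite ltr_wpDl // addr_ge0.
exists (r / d); first by rewrite divr_gt0.
move=> s t /andP[s0 sh] /andP[t0 th]; apply: hB => /=.
rewrite addrA opprD addrCA subrr addr0 normrN.
rewrite (le_lt_trans (ler_normD _ _)) // !normrZ !ger0_norm //.
have hr : r / d * d = r by rewrite divfK // gt_eqF.
have := ler_wpM2r (normr_ge0 v) sh; have := ler_wpM2r (normr_ge0 w) th.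
have : 0 < r / d by rewrite divr_gt0.
by rewrite -[X in _ -> _ -> _ -> _ < X]hr /d; move: (r / _) => z z0 h1 h2; lra.
Qed.

(** The mean value theorem is applied twice: along [w] to the increment
    [g q = f (h *: v + q) - f q], then along [v] to ['D_w f]. *)
Lemma second_difference f v w p (h : R) : 0 < h ->
  (forall s t, 0 <= s <= h -> 0 <= t <= h ->
     derivable f (s *: v + (t *: w + p)) w /\
     derivable ('D_w f) (s *: v + (t *: w + p)) v) ->
  exists2 st, 0 <= st.1 <= h /\ 0 <= st.2 <= h &
    f (h *: v + (h *: w + p)) - f (h *: w + p) - (f (h *: v + p) - f p) =
    h * (h * 'D_v ('D_w f) (st.1 *: v + (st.2 *: w + p))).
Proof.
move=> h0 hd; have hh : 0 <= h <= h by rewrite lexx ltW.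
have h00 : 0 <= (0 : R) <= h by rewrite lexx ltW.
pose g q := f (h *: v + q) - f q.
have dg t : 0 <= t <= h -> is_derive (t *: w + p) w g
    ('D_w f (h *: v + (t *: w + p)) - 'D_w f (t *: w + p)).
  move=> ht; have [d1 _] := hd _ _ hh ht; have [d2 _] := hd _ _ h00 ht.
  rewrite scale0r add0r in d2.
  apply: is_derive_add; last by apply: is_derive_opp; exact: derivableP.
  have E : (fun u : R => u^-1 *: (((fun q => f (h *: v + q)) \o shift (t *: w + p)) (u *: w)
      - f (h *: v + (t *: w + p)))) =
      (fun u : R => u^-1 *: ((f \o shift (h *: v + (t *: w + p))) (u *: w)
      - f (h *: v + (t *: w + p)))).
    by apply/funext => u; rewrite /= addrCA.
  by split; [rewrite /derivable E | rewrite /derive E].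
have [|t ht E] := @MVT_line g w p h h0; first by move=> t /dg [].
have [|s hs E'] := @MVT_line ('D_w f) v (t *: w + p) h h0.
  by move=> s hs; have [] := hd _ _ hs ht.
exists (s, t) => //=; rewrite -E'; case: (dg _ ht) => _ <-; rewrite -E /g.
by [].
Qed.

Lemma subr_subC (a b c d : R) : a - b - (c - d) = a - c - (b - d).
Proof. ring. Qed.

Lemma dist_half_le (a b c e : R) : `|a - c| < e / 2 -> `|b - c| < e / 2 -> `|a - b| <= e.
Proof.
move=> ac bc; rewrite (le_trans (ler_distD c _ _)) // [leRHS]splitr.
by rewrite lerD // ltW // distrC.
Qed.

(** The second difference of [f] over a small parallelogram is [h ^ 2] times either mixed
    derivative, each at some point of the parallelogram. Continuity at [p] puts both within [e / 2]
    of their values at [p]. *)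
Lemma schwarz f (A : set V) v w p : open A -> A p ->
  (forall q, A q -> [/\ derivable f q v, derivable f q w,
     derivable ('D_v f) q w & derivable ('D_w f) q v]) ->
  {for p, continuous ('D_v ('D_w f))} -> {for p, continuous ('D_w ('D_v f))} ->
  'D_v ('D_w f) p = 'D_w ('D_v f) p.
Proof.
move=> oA Ap hd c1 c2; apply/eqP; rewrite -subr_eq0 -normr_le0; apply/ler_addgt0Pl => e e0.
have e20 : 0 < e / 2 by rewrite divr_gt0.
rewrite addr0.
have /cvgrPdist_lt /(_ _ e20) n1 := c1; have /cvgrPdist_lt /(_ _ e20) n2 := c2.
have nA : nbhs p A by exact: open_nbhs_nbhs.
have [h h0 hB] := nbhs_parallelogram v w (filterI nA (filterI n1 n2)).
have [s t hs ht|[s t] /= [hs ht] E1] := @second_difference f v w p h h0.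
  by have [/hd[_ d1 _ d2] _] := hB _ _ hs ht; split; [exact: d1 | exact: d2].
have [s' t' hs' ht'|[s' t'] /= [hs' ht'] E2] := @second_difference f w v p h h0.
  rewrite addrCA; have [/hd[d1 _ d2 _] _] := hB _ _ ht' hs'.
  by split; [exact: d1 | exact: d2].
have [_ [/= b1 _]] := hB _ _ hs ht; have [_ [_ /= b2]] := hB _ _ ht' hs'.
(* Exchanging [v] and [w] only regroups the four terms of the second difference, so [E1] and [E2]
   share their left-hand side. *)
rewrite [h *: w + (h *: v + p)]addrCA [s' *: w + _]addrCA -subr_subC in E2.
have hN0 : h != 0 by rewrite gt_eqF.
have E := mulfI hN0 (mulfI hN0 (etrans (esym E1) E2)).
rewrite E in b1; exact: dist_half_le b1 b2.
Qed.

End Schwarz.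

(** * Uniqueness of the Levi-Civita connection *)

Section QuadraticForms.
Context {R : realType}.
Implicit Types (g : Pt R -> 'M[R]_4) (p : TPt R).

Lemma sum_deltar (f : 'I_4 -> R) b : \sum_a f a * (e_ b : Pt R) 0 a = f b.
Proof.
rewrite (bigD1 b) //= big1 ?addr0 => [|a ab]; first by rewrite mxE !eqxx mulr1.
by rewrite mxE eqxx (negbTE ab) mulr0.
Qed.

Lemma is_derive_coord_fibre p v w (a : 'I_4) :
  is_derive p (v, w) (fun q : TPt R => q.2 0 a) (w 0 a).
Proof.
apply: (@is_derive_snd R (Pt R) (Pt R) _ (fun z => z 0 a)).
by apply: (@is_derive_coord _ _ _ _ _ _ id); exact: is_derive_id.
Qed.

Lemma is_derive_linear_form (f : 'I_4 -> Pt R -> R) p v w (df : 'I_4 -> R) :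
  (forall a, is_derive p.1 v (f a) (df a)) ->
  is_derive p (v, w) (fun q : TPt R => \sum_a f a q.1 * q.2 0 a)
    (\sum_a (df a * p.2 0 a + f a p.1 * w 0 a)).
Proof.
move=> hf; apply: is_derive_sumr => a; apply: is_derive_mul.
  exact: is_derive_fst.
exact: is_derive_coord_fibre.
Qed.

Lemma is_derive_quadratic_form (f : 'I_4 -> 'I_4 -> Pt R -> R) p v w (df : 'I_4 -> 'I_4 -> R) :
  (forall a b, is_derive p.1 v (f a b) (df a b)) ->
  is_derive p (v, w) (fun q : TPt R => \sum_a \sum_b f a b q.1 * q.2 0 a * q.2 0 b)
    (\sum_a \sum_b (df a b * p.2 0 a * p.2 0 b +
       f a b p.1 * w 0 a * p.2 0 b + f a b p.1 * p.2 0 a * w 0 b)).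
Proof.
move=> hf; apply: is_derive_sumr => a; apply: is_derive_sumr => b.
have h := is_derive_mul (is_derive_mul (is_derive_fst w (hf a b))
  (is_derive_coord_fibre p v w a)) (is_derive_coord_fibre p v w b).
by apply: is_derive_eq h _; rewrite mulrDl.
Qed.

(** The matrix of a quadratic form is not assumed symmetric; this is twice its symmetric part, that
    is, the second derivative of the form. *)
Definition polar g (a b : 'I_4) (x : Pt R) : R := g x a b + g x b a.

Section FibreDerivatives.
Context {A : set (TPt R)} {L : TPt R -> R} {g : Pt R -> 'M[R]_4}
  (oA : open A)
  (hL : forall p, A p -> L p = \sum_a \sum_b g p.1 a b * p.2 0 a * p.2 0 b).

Local Notation s := (polar g).

Lemma dv_quadratic p b : A p -> dv b L p = \sum_a s a b p.1 * p.2 0 a.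
Proof.
move=> Ap; rewrite /dv.
have -> : 'D_(0, e_ b) L p =
    'D_(0, e_ b) (fun q : TPt R => \sum_a \sum_b g q.1 a b * q.2 0 a * q.2 0 b) p.
  exact: (@derive_open_eq R (TPt R) R A _ _ _ _ oA Ap hL).
have h := @is_derive_quadratic_form (fun a b x => g x a b) p 0 (e_ b) (fun _ _ => 0)
  (fun a c => is_derive0 _ _).
rewrite (derive_val (is_derive := h)).
under eq_bigr => a _.
  under eq_bigr do rewrite mul0r mul0r add0r.
  rewrite big_split /= sum_deltar; over.
rewrite big_split /= exchange_big /=.
under eq_bigr => c _.
  under eq_bigr do rewrite mulrAC.
  rewrite sum_deltar; over.
by rewrite -big_split /=; apply: eq_bigr => a _; rewrite -mulrDl addrC.
Qed.

Lemma dv_dv_quadratic p a b : A p -> dv a (dv b L) p = s a b p.1.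
Proof.
move=> Ap; rewrite {1}/dv.
have -> : 'D_(0, e_ a) (dv b L) p =
    'D_(0, e_ a) (fun q : TPt R => \sum_a s a b q.1 * q.2 0 a) p.
  apply: (@derive_open_eq R (TPt R) R A _ _ _ _ oA Ap) => q Aq; exact: dv_quadratic.
have h := @is_derive_linear_form (s^~ b) p 0 (e_ a) (fun=> 0) (fun=> is_derive0 _ _).
rewrite (derive_val (is_derive := h)).
under eq_bigr do rewrite mul0r add0r.
exact: sum_deltar.
Qed.

End FibreDerivatives.

(** A quadratic form vanishing on an open part of one fibre has zero second derivatives there, and
    these are its symmetrized coefficients. *)
Lemma quadratic_eq0 (A : set (TPt R)) (x y : Pt R) (Q : 'I_4 -> 'I_4 -> R) : open A -> A (x, y) ->
  (forall z, A (x, z) -> \sum_a \sum_b Q a b * z 0 a * z 0 b = 0) ->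
  forall a b, Q a b + Q b a = 0.
Proof.
(* Extending [Q] by zero to the other fibres gives a form that vanishes on all of [A], to which
   [dv_dv_quadratic] applies. *)
move=> oA Axy hQ a b; pose g z : 'M[R]_4 := if z == x then \matrix_(a, b) Q a b else 0.
have h p : A p -> (fun=> 0) p = \sum_a \sum_b g p.1 a b * p.2 0 a * p.2 0 b.
  case: p => u z Auz; rewrite /g /=; case: eqP Auz => [->|_] Az.
    apply: etrans (esym (hQ z Az)) _.
    by apply: eq_bigr => i _; apply: eq_bigr => j _; rewrite mxE.
  by rewrite big1 // => i _; rewrite big1 // => j _; rewrite mxE !mul0r.
have := dv_dv_quadratic oA h a b Axy; rewrite /polar /g /= eqxx !mxE => <-.
have -> : dv b (fun=> 0) = (fun=> 0) :> (TPt R -> R).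
  by apply/funext => q; case: (is_derive_const (0 : R) q (0, e_ b : Pt R)).
by case: (is_derive_const (0 : R) (x, y) (0, e_ a : Pt R)).
Qed.

End QuadraticForms.

(** If [S] has derivatives [A S + S A^T] and [B S + S B^T] in two directions, the hypothesis equates
    its mixed second derivatives. The terms [A S B^T] and [B S A^T] occur on both sides and cancel;
    what is left is skewness of the curvature. *)
Lemma commutator_metric (R : realType) n (A B A' B' S : 'M[R]_n) :
  A' *m S + A *m (B *m S + S *m B^T) + (B *m S + S *m B^T) *m A^T + S *m A'^T =
  B' *m S + B *m (A *m S + S *m A^T) + (A *m S + S *m A^T) *m B^T + S *m B'^T ->
  (A' - B' + A *m B - B *m A) *m S + S *m (A' - B' + A *m B - B *m A)^T = 0.
Proof.
have trN (C : 'M[R]_n) : (- C)^T = - C^T by apply/matrixP => i j; rewrite !mxE.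
have trD (C D : 'M[R]_n) : (C + D)^T = C^T + D^T by apply/matrixP => i j; rewrite !mxE.
rewrite !(trN, trD) !trmx_mul !(mulmxDl, mulmxDr, mulNmx, mulmxN) !mulmxA.
move: (A' *m S) (A *m B *m S) (A *m S *m B^T) (B *m S *m A^T) (S *m B^T *m A^T)
  (S *m A'^T) (B' *m S) (B *m A *m S) (S *m A^T *m B^T) (S *m B'^T).
move=> m1 m2 m3 m4 m5 m6 m7 m8 m9 m10 /matrixP h; apply/matrixP => i j.
by have := h i j; rewrite !mxE => {}h; lra.
Qed.

(** * Pseudo-Riemannian metrics with a given torsion-free connection *)

Section LeviCivita.
Context {R : realType} {M : set (Pt R)} {A : set (TPt R)} {L : TPt R -> R}
  {g : Pt R -> 'M[R]_4} {G : connection R}.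
Hypotheses (oM : open M) (fL : finsler M A L)
  (hL : forall p, A p -> L p = \sum_a \sum_b g p.1 a b * p.2 0 a * p.2 0 b)
  (symG : forall c a b x, M x -> G c a b x = G c b a x)
  (derG : forall c a b e x, M x -> derivable (G c a b) x (e_ e))
  (sprayG : forall p, A p -> forall c,
    2 * spray L c p = \sum_a \sum_b G c a b p.1 * p.2 0 a * p.2 0 b).

Let oA : open A. Proof. by case: fL => -[]. Qed.

Let fibre x : M x -> exists y, A (x, y).
Proof. by case: fL => -[_ _ h _] _ _ _ /h. Qed.

(* Twice the metric, because [hess L] carries a factor [1/2]. *)
Definition metric2 x : 'M[R]_4 := g x + (g x)^T.

Local Notation s := (polar g).

Lemma metric2E x a b : metric2 x a b = s a b x.
Proof. by rewrite !mxE. Qed.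

Lemma hess_metric2 p : A p -> hess L p = 2^-1 *: metric2 p.1.
Proof.
by move=> Ap; apply/matrixP => a b; rewrite !mxE (dv_dv_quadratic oA hL) // /polar.
Qed.

Lemma metric2_unit x : M x -> metric2 x \in unitmx.
Proof.
move=> /fibre[y Axy]; case: fL => _ _ _ /(_ _ Axy).
rewrite hess_metric2 //= -mul_scalar_mx unitmx_mul => /andP[].
by [].
Qed.

Lemma smooth_hess a b : smooth_on A (dv a (dv b L)).
Proof.
by case: fL => _ h _ _ n; have [_ /(_ ((0, e_ b) : TPt R)) [_]] := h n.+2; exact.
Qed.

(** Regularity of the metric is inherited from [L]: on [A] the symmetrized coefficients are second
    vertical derivatives of [L], and every point of [M] has a vector in [A] above it. *)
Lemma is_derive_metric2 x c a b : M x ->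
  is_derive x (e_ c) (s a b) ('D_(e_ c) (s a b) x).
Proof.
move=> /fibre[y Axy]; apply: derivableP.
have [/(_ _ Axy) dP _] := smooth_hess a b 1.
have h := derivableP (diff_derivable (v := (e_ c, 0) : TPt R) dP).
have h' := @is_derive_open_eq R (TPt R) R A _ (fun q => s a b q.1) _ _ _ oA Axy
   (fun q Aq => dv_dv_quadratic oA hL a b Aq) h.
by case: h' => h' _; exact: h'.
Qed.

Lemma derive_metric2 x y c a b : A (x, y) ->
  'D_(e_ c) (s a b) x = 'D_((e_ c, 0) : TPt R) (dv a (dv b L)) (x, y).
Proof.
move=> Axy.
have -> : 'D_(e_ c) (s a b) x = 'D_((e_ c, 0) : TPt R) (fun q : TPt R => s a b q.1) (x, y).
  by [].
apply/esym; apply: (@derive_open_eq R (TPt R) R A _ _ _ _ oA Axy) => q Aq.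
exact: (dv_dv_quadratic oA hL a b Aq).
Qed.

Lemma A_in_M p : A p -> M p.1.
Proof. by case: fL => -[_ h _ _] _ _ _ /h[]. Qed.

Lemma dx_dv_quadratic p c b : A p ->
  dx c (dv b L) p = \sum_a 'D_(e_ c) (s a b) p.1 * p.2 0 a.
Proof.
move=> Ap; have Mp := A_in_M Ap; rewrite /dx.
have -> : 'D_(e_ c, 0) (dv b L) p =
    'D_(e_ c, 0) (fun q : TPt R => \sum_a s a b q.1 * q.2 0 a) p.
  apply: (@derive_open_eq R (TPt R) R A _ _ _ _ oA Ap) => q Aq.
  exact: (dv_quadratic oA hL b Aq).
have h := @is_derive_linear_form _ (s^~ b) p (e_ c) 0 _
  (fun a => is_derive_metric2 c a b Mp).
rewrite (derive_val (is_derive := h)); apply: eq_bigr => a _.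
by rewrite mxE mulr0 addr0.
Qed.

Lemma dx_quadratic p b : A p ->
  dx b L p = \sum_a \sum_c (2^-1 : R) * 'D_(e_ b) (s a c) p.1 * p.2 0 a * p.2 0 c.
Proof.
move=> Ap; have Mp := A_in_M Ap; rewrite /dx.
(* Derivability is known for [polar g] and not for [g], so [L] is first rewritten with half of
   [polar g]. *)
have -> : 'D_(e_ b, 0) L p =
    'D_(e_ b, 0) (fun q : TPt R => \sum_a \sum_c (2^-1 * s a c q.1) * q.2 0 a * q.2 0 c) p.
  apply: (@derive_open_eq R (TPt R) R A _ _ _ _ oA Ap) => q Aq.
  rewrite hL //.
  have -> : \sum_a \sum_c 2^-1 * s a c q.1 * q.2 0 a * q.2 0 c =
      2^-1 * (\sum_a \sum_c g q.1 a c * q.2 0 a * q.2 0 c +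
              \sum_a \sum_c g q.1 c a * q.2 0 a * q.2 0 c).
    rewrite -big_split mulr_sumr; apply: eq_bigr => a _.
    rewrite -big_split mulr_sumr; apply: eq_bigr => c _.
    by rewrite /polar /=; ring.
  have -> : \sum_a \sum_c g q.1 c a * q.2 0 a * q.2 0 c =
      \sum_a \sum_c g q.1 a c * q.2 0 a * q.2 0 c.
    by rewrite exchange_big; apply: eq_bigr => a _; apply: eq_bigr => c _; rewrite mulrAC.
  by set z := \sum_a _; lra.
have hs a c : is_derive p.1 (e_ b) (fun x => 2^-1 * s a c x) ((2^-1 : R) * 'D_(e_ b) (s a c) p.1).
  apply: is_derive_eq (is_derive_mul (is_derive_const (2^-1 : R) _ _)
    (is_derive_metric2 b a c Mp)) _.
  by rewrite mul0r add0r.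
have h := @is_derive_quadratic_form _ (fun a c x => 2^-1 * s a c x) p (e_ b) 0 _ hs.
rewrite (derive_val (is_derive := h)); apply: eq_bigr => a _; apply: eq_bigr => c _.
by rewrite !mxE !mulr0 mul0r !addr0.
Qed.

(** Since [hess L] is half of [metric2], the two factors 2 on the left cancel the [4^-1] of the
    spray. *)
Lemma lowered_spray p b : A p ->
  \sum_d s b d p.1 * (2 * spray L d p) =
  \sum_c p.2 0 c * dx c (dv b L) p - dx b L p.
Proof.
move=> Ap; pose r : 'cV[R]_4 := \col_b (\sum_c p.2 0 c * dx c (dv b L) p - dx b L p).
have hu : hess L p \in unitmx by case: fL => _ _ _; apply.
have sE d : spray L d p = 4^-1 * (invmx (hess L p) *m r) d 0.
  by rewrite /spray mxE; congr (_ * _); apply: eq_bigr => c _; rewrite !mxE.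
have : (hess L p *m (invmx (hess L p) *m r)) b 0 = r b 0 by rewrite mulKVmx.
rewrite [RHS]mxE => <-; rewrite mxE; apply: eq_bigr => d _.
rewrite sE hess_metric2 // [in RHS]mxE metric2E.
move: (_ *m _) => z; lra.
Qed.

(* The Christoffel symbols of the first kind are read off the spray by
   polarization. *)
Lemma metric_parallel x c : M x ->
  pd_mx c metric2 x =
  conn_mx G c x *m metric2 x + metric2 x *m (conn_mx G c x)^T.
Proof.
move=> Mx; have [y Axy] := fibre Mx.
pose T (b a d : 'I_4) := \sum_i s b i x * G i a d x.
have Tsym b a d : T b a d = T b d a by apply: eq_bigr => i _; rewrite symG.
have ssym a b : s a b = s b a by apply/funext => z; rewrite /polar addrC.
pose D (e a b : 'I_4) : R := 'D_(e_ e) (s a b) x.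
have Dsym e a b : D e a b = D e b a by rewrite /D ssym.
(* The geodesic equation with lowered index [b], as a quadratic form in the velocity: [T] comes from
   the connection, the [D] terms from the right-hand side of [lowered_spray]. *)
pose Q (b a d : 'I_4) : R := T b a d - D d a b + 2^-1 * D b a d.
have hQ b z : A (x, z) -> \sum_a \sum_d Q b a d * z 0 a * z 0 d = 0.
  move=> Axz; have := lowered_spray b Axz.
  under eq_bigr do rewrite sprayG // mulr_sumr.
  rewrite dx_quadratic //=; under [X in _ = X - _]eq_bigr do rewrite dx_dv_quadratic //.
  move=> /=.
  have -> : \sum_i \sum_i0 s b i x * (\sum_b0 G i i0 b0 x * z 0 i0 * z 0 b0) =
      \sum_a \sum_d T b a d * z 0 a * z 0 d.
    rewrite exchange_big; apply: eq_bigr => a _; rewrite /T.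
    under [RHS]eq_bigr do rewrite -mulrA mulr_suml.
    rewrite [RHS]exchange_big; apply: eq_bigr => i _; rewrite mulr_sumr.
    by apply: eq_bigr => d _; rewrite !mulrA.
  have -> : \sum_d z 0 d * (\sum_a 'D_(e_ d) (s a b) x * z 0 a) =
      \sum_a \sum_d D d a b * z 0 a * z 0 d.
    rewrite exchange_big; apply: eq_bigr => d _; rewrite mulr_sumr.
    by apply: eq_bigr => a _; rewrite /D mulrC.
  move/eqP; rewrite -subr_eq0 opprB => /eqP E; apply: etrans E.
  rewrite -sumrB -big_split; apply: eq_bigr => a _.
  rewrite -sumrB -big_split; apply: eq_bigr => d _.
  rewrite /= /Q /D; move: (T b a d) (z 0 a) (z 0 d) => *.
  by move: ('D_(e_ d) (s a b) x : R) ('D_(e_ b) (s a d) x : R) => *; ring.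
apply/matrixP => a b; rewrite !mxE.
have -> : \sum_j conn_mx G c x a j * metric2 x j b = T b c a.
  by apply: eq_bigr => j _; rewrite !mxE /polar mulrC [g x b j + _]addrC.
have -> : \sum_j metric2 x a j * (conn_mx G c x)^T j b = T a c b.
  by apply: eq_bigr => j _; rewrite !mxE.
have -> : (fun z => metric2 z a b) = s a b by apply/funext => z; rewrite metric2E.
rewrite -/(D c a b).
(* In the sum of the polarized identities for [Q b] at [(a, c)] and [Q a] at [(b, c)], all
   derivatives cancel except those along [c]. *)
have h1 := @quadratic_eq0 _ A x y (Q b) oA Axy (hQ b) a c.
have h2 := @quadratic_eq0 _ A x y (Q a) oA Axy (hQ a) b c.
rewrite /Q in h1 h2.
have := Tsym b a c; have := Tsym a b c; have := Dsym b a c; have := Dsym a b c.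
have := Dsym c a b; have := Dsym b c a; have := Dsym a c b; lra.
Qed.

(** Smoothness is available for [L] on [A], so Schwarz's theorem is applied there, to a second
    vertical derivative of [L] in two directions [(e_ i, 0)]. *)
Lemma pd_metric2_comm x e e' a b : M x ->
  'D_(e_ e') ('D_(e_ e) (s a b)) x = 'D_(e_ e) ('D_(e_ e') (s a b)) x.
Proof.
move=> /fibre[y Axy].
have key i j : 'D_(e_ i) ('D_(e_ j) (s a b)) x =
    'D_((e_ i, 0) : TPt R) ('D_((e_ j, 0) : TPt R) (dv a (dv b L))) (x, y).
  have -> : 'D_(e_ i) ('D_(e_ j) (s a b)) x =
    'D_((e_ i, 0) : TPt R) (fun q : TPt R => 'D_(e_ j) (s a b) q.1) (x, y) by [].
  apply: (@derive_open_eq R (TPt R) R A _ _ _ _ oA Axy) => -[u z] Auz.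
  exact: derive_metric2.
rewrite !key; have hP := smooth_hess a b.
apply: (@schwarz R (TPt R) _ A _ _ _ oA Axy).
- move=> q Aq; have [h0 h1] := hP 2.
  by split; [exact: (diff_derivable (h0 q Aq)) | exact: (diff_derivable (h0 q Aq))
    | exact: (diff_derivable ((h1 _).1 q Aq)) | exact: (diff_derivable ((h1 _).1 q Aq))].
- exact: (((hP 2).2 _).2 _ _ Axy).
- exact: (((hP 2).2 _).2 _ _ Axy).
Qed.

(** Differentiating [metric_parallel] once more gives both mixed second derivatives of the metric;
    they agree, and [commutator_metric] concludes. *)
Lemma curv_metric2 x e e' : M x ->
  curv G e e' x *m metric2 x + metric2 x *m (curv G e e' x)^T = 0.
Proof.
move=> Mx.
have hS c z a b : M z -> 'D_(e_ c) (s a b) z =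
    \sum_d G d c a z * s d b z + \sum_d s a d z * G d c b z.
  move=> Mz; have /matrixP/(_ a b) := metric_parallel c Mz; rewrite !mxE.
  have -> : (fun z => metric2 z a b) = s a b by apply/funext => u; rewrite metric2E.
  by move=> ->; congr (_ + _); apply: eq_bigr => d _; rewrite !mxE.
have hD i j a b : 'D_(e_ j) ('D_(e_ i) (s a b)) x =
    (pd_mx j (conn_mx G i) x *m metric2 x + conn_mx G i x *m pd_mx j metric2 x
     + pd_mx j metric2 x *m (conn_mx G i x)^T + metric2 x *m (pd_mx j (conn_mx G i) x)^T) a b.
  have -> : 'D_(e_ j) ('D_(e_ i) (s a b)) x = 'D_(e_ j)
      (fun z => \sum_d G d i a z * s d b z + \sum_d s a d z * G d i b z) x.
    by apply: (@derive_open_eq R (Pt R) R M _ _ _ _ oM Mx) => z; exact: hS.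
  have dG d c := derivableP (@derG d i c j x Mx).
  have dS c d := is_derive_metric2 j c d Mx.
  have h := is_derive_add (is_derive_sumr (fun d => is_derive_mul (dG d a) (dS d b)))
    (is_derive_sumr (fun d => is_derive_mul (dS a d) (dG d b))).
  rewrite (derive_val (is_derive := h)) !big_split /= addrA.
  have sE c d : (fun z => metric2 z c d) = s c d by apply/funext => u; rewrite metric2E.
  rewrite !mxE; congr (_ + _ + _ + _); apply: eq_bigr => d _.
  - by rewrite !mxE conn_mxE.
  - by rewrite !mxE sE.
  - by rewrite !mxE sE.
  - by rewrite !mxE conn_mxE.
apply: commutator_metric; rewrite -!metric_parallel //.
by apply/matrixP => a b; rewrite -!hD; exact: pd_metric2_comm.
Qed.

End LeviCivita.

(** * Exponential law metrics *)

(* A metric invariant under [id - nu u X] has [d_theta] in its kernel. *)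
Lemma scaling_degenerate (R : realType) (F a b nu q : R) (S : 'M[R]_4) : F != 0 ->
  (forall i j, S i j = S j i) ->
  (F *: frame_mx 0 a b nu q) *m S + S *m (F *: frame_mx 0 a b nu q)^T = 0 ->
  S \notin unitmx.
Proof.
move=> F0 Ssym /matrixP hS; have h j := hS ith j.
have sc (u : R) : F * u = 0 -> u = 0.
  by move/eqP; rewrite mulf_eq0 (negbTE F0) => /eqP.
have [hh hf ht hr] : [/\ S ith ith = 0, S ith iph = 0,
    2 * S ith it = nu * (a * S ith it + S ith ir) &
    2 * S ith ir = - (nu * a * (a * S ith it + S ith ir))].
  have := h iph; have := h ith; have := h ir; have := h it.
  rewrite !mxE !sum4 !mxE /=.
  move: (S ith it) (S ith ir) (S ith ith) (S ith iph) => st sr sh sf h1 h2 h3 h4.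
  split.
  - by apply: sc; lra.
  - by apply: sc; lra.
  - by apply/eqP; rewrite -subr_eq0; apply/eqP; apply: sc; lra.
  - by apply/eqP; rewrite -subr_eq0; apply/eqP; apply: sc; lra.
(* Comparing [a] times the t-equation with the r-equation gives [S ith ir = - a * S ith it]; then
   [a * S ith it + S ith ir] is zero, and the t-equation kills [S ith it]. *)
have hr' : S ith ir = - a * S ith it by have := congr1 ( *%R a) ht; lra.
have ht' : S ith it = 0 by move: ht; rewrite hr'; lra.
apply/negP => Su; have : (e_ ith : Pt R) *m S = 0.
  apply/rowP => j; rewrite -rowE !mxE.
  case: j => [[|[|[|[|]]]] hj] //;
    [rewrite -ht' | rewrite -[RHS](mulr0 (- a)) -ht' -hr' | rewrite -hh | rewrite -hf];
    congr (S _ _); exact/val_inj.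
move/(congr1 (mulmx^~ (invmx S))); rewrite mulmxK // mul0mx => /rowP /(_ ith) /eqP.
by rewrite !mxE eqxx oner_eq0.
Qed.

(** The spray fixes the quadratic form of the coefficients on an open part of each fibre, hence
    their symmetrization; absence of torsion does the rest. *)
Lemma canonical_connection_unique (R : realType) (M : set (Pt R)) A L (G G' : connection R) :
  canonical_connection M A L G -> canonical_connection M A L G' ->
  forall c a b x, M x -> G c a b x = G' c a b x.
Proof.
move=> [[[oA _ h _] _ _ _] [_ sG] eG] [_ [_ sG'] eG'] c a b x Mx.
have [y Axy] := h x Mx; pose Q (a b : 'I_4) : R := G c a b x - G' c a b x.
have := @quadratic_eq0 _ A x y Q oA Axy _ a b; rewrite /Q (sG c b a) // (sG' c b a) //.
move=> hQ; suff /hQ : forall z, A (x, z) -> \sum_a \sum_b Q a b * z 0 a * z 0 b = 0 by lra.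
move=> z Az; have := eG' _ Az c; rewrite eG //= => /eqP; rewrite -subr_eq0 => /eqP E.
apply: etrans E; rewrite -sumrB; apply: eq_bigr => i _; rewrite -sumrB.
by apply: eq_bigr => j _; rewrite /Q; ring.
Qed.

Section ExponentialLaw.
Context {R : realType} {M : set (Pt R)} {A : set (TPt R)} {L : TPt R -> R}
  {k : nat -> fun2 R} {phi : fun2 R}
  (HM : spherical_domain M) (HL : exponential_law_berwald M A L k phi).

Local Notation G := (sph_connection k).

Let oM : open M. Proof. by case: HM. Qed.

Let kf i (x : Pt R) : R := k i (x 0 it) (x 0 ir).
Let af (x : Pt R) : R := fa k (x 0 it) (x 0 ir).
Let bf (x : Pt R) : R := fb k (x 0 it) (x 0 ir).
Let nuf (x : Pt R) : R := a3 k (x 0 it) (x 0 ir) / fF k (x 0 it) (x 0 ir).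
Let f7 (x : Pt R) : R := a7 k (x 0 it) (x 0 ir).
Let f11 (x : Pt R) : R := a11 k (x 0 it) (x 0 ir).
Let Ff x : R := fdF (af x) (bf x) (f7 x) (f11 x).
Let Fr i x : 'M[R]_4 := frame_mx i (af x) (bf x) (nuf x) (qf x).

Lemma tr_projM x : M x -> tr_proj M (x 0 it, x 0 ir).
Proof. by move=> Mx; exists x. Qed.

Lemma sin_theta_neq0 x : M x -> sin (x 0 ith) != 0.
Proof. by case: HM => _ _ /(_ x) h /h [_ /sin_gt0_pi /lt0r_neq0]. Qed.

Lemma frame_dataM x : M x ->
  frame_data (kf^~ x) (fun i => d_t (k i) (x 0 it) (x 0 ir))
    (fun i => d_r (k i) (x 0 it) (x 0 ir)) (af x) (bf x) (nuf x) (f7 x) (f11 x).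
Proof.
move=> /tr_projM Mx; have [hD hE hF] := ExpDEF HL Mx.
by apply: class2_frame_data => //; [exact: ExpK10 HL _ _ Mx | exact: ExpRel HL _ _ Mx].
Qed.

Lemma pdsmooth_conn c a b : pdsmooth M (G c a b).
Proof. by case: (ExpConn HL) => _ [h _] _; apply: smooth_on_pdsmooth. Qed.

(** Each of the ten functions occurs alone as a coefficient of the canonical connection, which is
    smooth on [M]. *)
Lemma pdsmooth_kf i : (0 < i <= 10)%N -> pdsmooth M (kf i).
Proof.
case: i => [//|[|[|[|[|[|[|[|[|[|[|i]]]]]]]]]]] // _.
- exact: (pdsmooth_conn it it it).
- exact: (pdsmooth_conn it it ir).
- exact: (pdsmooth_conn it ir ir).
- exact: (pdsmooth_conn ir it it).
- exact: (pdsmooth_conn ir ir ir).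
- exact: (pdsmooth_conn ir it ir).
- exact: (pdsmooth_conn it ith ith).
- exact: (pdsmooth_conn ith ith it).
- exact: (pdsmooth_conn ith ith ir).
- exact: (pdsmooth_conn ir ith ith).
Qed.

Definition dkf (e i : nat) (x : Pt R) : R :=
  dir_val (d_t (k i) (x 0 it) (x 0 ir)) (d_r (k i) (x 0 it) (x 0 ir)) 0 e.

Lemma is_derive_kf x (e : 'I_4) i : M x -> (0 < i <= 10)%N ->
  is_derive x (e_ e) (kf i) (dkf e i x).
Proof.
move=> Mx hi; have h := pdsmooth_is_derive e (pdsmooth_kf hi) Mx.
have [e1|e1] := leqP e 1; last first.
  have -> : dkf e i x = 0 by case: e e1 {h} => [[|[|[|[|]]]] he].
  exact: is_derive_angle.
have E : e = it \/ e = ir.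
  by case: e e1 {h} => [[|[|]] he] // _; [left|right]; apply/val_inj.
case: E h => ->; first by rewrite [X in is_derive _ _ _ X]derive_t.
by rewrite [X in is_derive _ _ _ X]derive_r.
Qed.

Lemma pdsmooth_kt i : (0 < i <= 10)%N ->
  pdsmooth M (fun x : Pt R => d_t (k i) (x 0 it) (x 0 ir)).
Proof.
move=> /pdsmooth_kf h.
by apply: (pdsmooth_ext oM _ (pdsmooth_derive it h)) => x _; rewrite derive_t.
Qed.

Lemma pdsmooth_kr i : (0 < i <= 10)%N ->
  pdsmooth M (fun x : Pt R => d_r (k i) (x 0 it) (x 0 ir)).
Proof.
move=> /pdsmooth_kf h.
by apply: (pdsmooth_ext oM _ (pdsmooth_derive ir h)) => x _; rewrite derive_r.
Qed.

Ltac pds := repeat (first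
  [ solve [apply: pdsmooth_kf => //] | solve [apply: pdsmooth_kt => //]
  | solve [apply: pdsmooth_kr => //]
  | apply: (pdsmoothD oM) | apply: (pdsmoothN oM) | apply: (pdsmoothM oM)
  | exact: (pdsmooth_cst oM) ]).

Lemma kf10_neq0 x : M x -> kf 10 x != 0.
Proof. by move=> /tr_projM; exact: ExpK10 HL _ _. Qed.

Lemma pdsmooth_af : pdsmooth M af.
Proof.
apply: (pdsmoothM oM (f := kf 7)); first by pds.
by apply: (pdsmoothV oM kf10_neq0); pds.
Qed.

Lemma pdsmooth_bf : pdsmooth M bf.
Proof.
apply: (pdsmoothM oM (f := kf 8)); first by pds.
by apply: (pdsmoothV oM kf10_neq0); pds.
Qed.

Lemma pdsmooth_f7 : pdsmooth M f7.
Proof. by pds. Qed.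

Lemma pdsmooth_f11 : pdsmooth M f11.
Proof. by pds. Qed.

Lemma pdsmooth_Ff : pdsmooth M Ff.
Proof.
apply: (pdsmoothM oM); first exact: pdsmooth_bf.
apply: (pdsmoothD oM); last exact: pdsmooth_f11.
apply: (pdsmoothM oM); [exact: pdsmooth_af | exact: pdsmooth_f7].
Qed.

Lemma pdsmooth_nuf : pdsmooth M nuf.
Proof.
have h : pdsmooth M (fun x : Pt R => a3 k (x 0 it) (x 0 ir)) by rewrite /a3; pds.
apply: (pdsmoothM oM) => //; apply: (pdsmoothV oM).
  by move=> x /tr_projM Mx; have [_ _] := ExpDEF HL Mx.
apply: (pdsmoothD oM); first by apply: (pdsmoothM oM) => //; exact: pdsmooth_af.
by rewrite /a1; pds.
Qed.

(** The cotangent of theta is itself a connection coefficient, with upper index phi. *)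
Lemma pdsmooth_wf : pdsmooth M wf.
Proof. exact: (pdsmooth_conn iph ith iph). Qed.

Lemma is_derive_af x (e : 'I_4) : M x ->
  is_derive x (e_ e) af (frame_da (kf^~ x) (af x) e).
Proof.
move=> Mx; have k10 := kf10_neq0 Mx.
apply: is_derive_eq (is_derive_mul (is_derive_kf e Mx (i := 7) isT)
  (is_derive_inv k10 (is_derive_kf e Mx (i := 10) isT))) _.
by rewrite -(frame_data_da (frame_dataM Mx)) /dkf; field.
Qed.

Lemma is_derive_bf x (e : 'I_4) : M x ->
  is_derive x (e_ e) bf (frame_db (kf^~ x) (bf x) e).
Proof.
move=> Mx; have k10 := kf10_neq0 Mx.
apply: is_derive_eq (is_derive_mul (is_derive_kf e Mx (i := 8) isT)
  (is_derive_inv k10 (is_derive_kf e Mx (i := 10) isT))) _.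
by rewrite -(frame_data_db (frame_dataM Mx)) /dkf; field.
Qed.

Lemma is_derive_Fr x (e : 'I_4) i dnu m n : M x -> is_derive x (e_ e) nuf dnu ->
  is_derive x (e_ e) (fun z => Fr i z m n)
    (dframe i (af x) (bf x) (nuf x) (qf x) (frame_da (kf^~ x) (af x) e)
      (frame_db (kf^~ x) (bf x) e) dnu (dir_val 0 0 (2 * wf x * qf x) e) m n).
Proof.
move=> Mx hnu; under eq_fun do rewrite mxE.
apply: is_derive_frame => //; [exact: is_derive_af | exact: is_derive_bf |].
by apply: is_derive_qf; exact: sin_theta_neq0.
Qed.

Lemma nabla_Fr x (e : 'I_4) i dnu : M x -> is_derive x (e_ e) nuf dnu ->
  nabla G e (Fr i) x = cov_frame e i (kf^~ x) (af x) (bf x) (nuf x) (qf x) (wf x)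
    (frame_da (kf^~ x) (af x) e) (frame_db (kf^~ x) (bf x) e) dnu
    (dir_val 0 0 (2 * wf x * qf x) e).
Proof.
move=> Mx hnu; rewrite /nabla conn_mx_gam; last exact: sin_theta_neq0.
congr (_ - _ + _); apply/matrixP => m n; rewrite !mxE.
by rewrite (derive_val (is_derive := is_derive_Fr i m n Mx hnu)).
Qed.

Lemma pd_conn x (e e' : 'I_4) : M x -> pd_mx e' (conn_mx G e) x =
  mx4 (dgam e (kf^~ x) (qf x) (wf x) (fun i => dkf e' i x)
    (dir_val 0 0 (2 * wf x * qf x) e') (dir_val 0 0 (- 1 - wf x ^+ 2) e')).
Proof.
move=> Mx; apply/matrixP => m n; rewrite !mxE.
have s0 := sin_theta_neq0 Mx.
have h := is_derive_gam e m n (fun i => @is_derive_kf x e' i Mx)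
  (is_derive_qf e' s0) (is_derive_wf e' s0).
rewrite -(derive_val (is_derive := h));
apply: (@derive_open_eq R (Pt R) R M _ _ _ (e_ e') oM Mx) => z Mz.
by rewrite (conn_mx_gam k e (sin_theta_neq0 Mz)) mxE.
Qed.

Lemma curvM x (e e' : 'I_4) : M x ->
  curv G e e' x = \sum_(j < 4) kap (Ff x) (f7 x) (f11 x) e e' j *: Fr j x.
Proof.
move=> Mx; rewrite /curv !pd_conn // !conn_mx_gam; try exact: sin_theta_neq0.
exact: (curv_frame (qf x) (wf x) (frame_dataM Mx)).
Qed.

Lemma derivable_conn x (e a b c : 'I_4) : M x -> derivable (G c a b) x (e_ e).
Proof. by move=> Mx; case: (pdsmooth_is_derive e (pdsmooth_conn c a b) Mx). Qed.

Lemma lie_delta2 (p : TPt R) e e' : M p.1 ->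
  lie (delta G e) (delta G e') p = linv (curv G e e') p.
Proof. by move=> Mp; apply: lie_delta_delta => *; exact: derivable_conn. Qed.

(** A bracket at [p] depends on [Y] only near [p], and the vectors over [M] form an open set. *)
Lemma lie_ext (X Y Y' : vfield R) (p : TPt R) : (forall q, M q.1 -> Y q = Y' q) ->
  M p.1 -> lie X Y p = lie X Y' p.
Proof.
move=> YY' Mp.
have oT : open [set q : TPt R | M q.1].
  by apply: open_comp oM => q _; exact: cvg_fst.
have e1 : 'D_(X p) Y p = 'D_(X p) Y' p.
  exact: (@derive_open_eq R (TPt R) (TPt R) _ _ _ _ _ oT Mp YY').
by rewrite /lie e1 (YY' p Mp).
Qed.

Lemma A_M (p : TPt R) : A p -> M p.1.
Proof. by case: (ExpConn HL) => -[[_ h _ _] _ _ _] _ _ /h[]. Qed.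

Lemma A_fibre x : M x -> exists y, A (x, y).
Proof. by case: (ExpConn HL) => -[[_ _ h _] _ _ _] _ _ /h. Qed.

Lemma derivable_nuf x (e : 'I_4) : M x -> is_derive x (e_ e) nuf ('D_(e_ e) nuf x).
Proof. exact: pdsmooth_is_derive pdsmooth_nuf. Qed.

Lemma derivable_Fr x (e : 'I_4) i m n : M x -> derivable (fun z => Fr i z m n) x (e_ e).
Proof. by move=> Mx; case: (is_derive_Fr i m n Mx (derivable_nuf e Mx)). Qed.

Lemma fFM x : M x -> Ff x != 0 /\ bf x != 0.
Proof. by move=> /frame_dataM[]. Qed.

Lemma lie_tr (p : TPt R) : M p.1 ->
  lie (delta G it) (delta G ir) p = linv (fun z => - Ff z *: Fr 0 z) p.
Proof.
move=> Mp; rewrite lie_delta2 // /linv curvM // sum4 /=.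
by rewrite !scale0r !addr0.
Qed.

(** The bracket of [delta G e] with [- F Z] consists of a multiple of [Z] and, by
    [cov_frame_scaling], a multiple of [u X]. Proportionality to [F Z] forces the latter to vanish,
    as seen on any one vector with nonzero [u]. *)
Lemma derive_nuf_proportional (e : 'I_4) :
  proportional_on A (lie (delta G e) (lie (delta G it) (delta G ir)))
    (lie (delta G it) (delta G ir)) ->
  forall x, M x -> 'D_(e_ e) nuf x = frame_dnu (kf^~ x) (af x) (nuf x) e.
Proof.
move=> prop x Mx; have [y Axy] := A_fibre Mx; have [l] := prop _ Axy.
have Mp : M (x, y).1 by [].
have hF := pdsmooth_is_derive e (pdsmoothN oM pdsmooth_Ff) Mx.
rewrite (lie_ext _ lie_tr Mp) lie_tr // lie_delta_linv; last first.
  move=> i j; have h0 := is_derive_Fr 0 i j Mx (derivable_nuf e Mx).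
  by case: (is_derive_mul hF h0) => h _; under eq_fun do rewrite mxE.
rewrite /linv /= nabla_scale; [|by case: hF|by move=> i j; exact: derivable_Fr].
rewrite (nabla_Fr _ Mx (derivable_nuf e Mx)) cov_frame_scaling //; first last.
- by have [] := frame_dataM Mx.
- by have [] := frame_dataM Mx.
- by have [] := frame_dataM Mx.
have F0 := (fFM Mx).1; have u0 := ExpU HL Axy.
have uE : udot k (x, y) = y 0 it - af x * y 0 ir by [].
rewrite uE in u0.
set d := 'D__ _ x; set dn := frame_dnu _ _ _ _; set D := 'D__ _ x.
case=> _ /rowP h; have := h it; have := h ir; rewrite !mxE !sum4 !mxE /=.
move: (Ff x) (af x) (nuf x) (y 0 it) (y 0 ir) F0 u0 => F a nu yt yr F0 u0 hr ht.
(* The t-component minus [a] times the r-component is the form [u], which kills [X] and sends [Z y]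
   to [u]; it isolates the coefficient of [Z]. *)
have har := congr1 ( *%R a) hr.
have hd : (d + l * F) * (yt - a * yr) = 0 by lra.
move/eqP: hd; rewrite mulf_eq0 (negbTE u0) orbF => /eqP hd.
have hD : (dn - D) * (F * (yt - a * yr)) = 0.
  have dE : d = - (l * F) by lra.
  by move: hr; rewrite dE => hr; lra.
by move/eqP: hD; rewrite !mulf_eq0 (negbTE u0) (negbTE F0) !orbF subr_eq0 => /eqP.
Qed.

Lemma derive_nuf x (e : 'I_4) : M x ->
  'D_(e_ e) nuf x = frame_dnu (kf^~ x) (af x) (nuf x) e.
Proof.
move=> Mx; have [e1|e1] := leqP e 1; last first.
  have h := is_derive_angle (fun t r => a3 k t r / fF k t r) x e1.
  by rewrite (derive_val (is_derive := h)); case: e e1 {h} => [[|[|[|[|]]]] he].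
apply: derive_nuf_proportional => //.
have [->|->] : e = it \/ e = ir.
  by case: e e1 => [[|[|]] he] // _; [left|right]; apply/val_inj.
- exact: ExpPropT HL.
- exact: ExpPropR HL.
Qed.

Lemma nabla_FrE x (e i : 'I_4) : M x ->
  nabla G e (Fr i) x =
  \sum_(j < 4) lam e (kf^~ x) (af x) (qf x) (wf x) i j *: Fr j x.
Proof.
move=> Mx; rewrite (nabla_Fr i Mx (derivable_nuf e Mx)) derive_nuf //.
by have [h7 h8 h9 _ _ _ _ _ _ _ _ _ _ _ _ _ _ _] := frame_dataM Mx; exact: cov_frameE.
Qed.

Lemma pdsmooth_lam (e i j : 'I_4) :
  pdsmooth M (fun x => lam e (kf^~ x) (af x) (qf x) (wf x) i j).
Proof.
have h0 := pdsmooth_cst oM (0 : R); have hw := pdsmooth_wf; have ha := pdsmooth_af.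
have hwq : pdsmooth M (fun x => - (wf x * qf x)).
  apply: (pdsmooth_ext oM _ (pdsmooth_conn ith iph iph)) => x Mx.
  by rewrite /sph_connection /= /wf /qf; field; exact: sin_theta_neq0.
have hkq : pdsmooth M (fun x => - (kf 10 x * qf x)).
  exact: (pdsmoothN oM (pdsmooth_conn ir iph iph)).
have hl m n p : (0 < m <= 10)%N -> (0 < n <= 10)%N -> (0 < p <= 10)%N ->
    pdsmooth M (fun x => af x * kf m x + kf n x - kf p x).
  move=> hm hn hp; apply: (pdsmoothD oM); last by apply: (pdsmoothN oM); exact: pdsmooth_kf.
  apply: (pdsmoothD oM); last exact: pdsmooth_kf.
  by apply: (pdsmoothM oM ha); exact: pdsmooth_kf.
case: e => [[|[|[|[|]]]] he] //; case: i => [[|[|[|[|]]]] hi] //;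
  case: j => [[|[|[|[|]]]] hj] //=; try exact: h0; try exact: hw;
  try exact: hwq; try exact: hkq; try exact: pdsmooth_kf; exact: hl.
Qed.

(** Smoothness of the coefficients is included because each further bracket differentiates them. *)
Definition frame_span (B : Pt R -> 'M[R]_4) : Prop :=
  exists c : 'I_4 -> Pt R -> R, (forall j, pdsmooth M (c j)) /\
    forall x, M x -> B x = \sum_j c j x *: Fr j x.

Lemma frame_span_curv (e e' : 'I_4) : frame_span (curv G e e').
Proof.
exists (fun j x => kap (Ff x) (f7 x) (f11 x) e e' j); split; last by move=> x; exact: curvM.
have [[hF h7] h11] := (pdsmooth_Ff, pdsmooth_f7, pdsmooth_f11).
have h0 c := pdsmooth_cst oM (c : R).
move=> j; case: e => [[|[|[|[|]]]] he] //; case: e' => [[|[|[|[|]]]] he'] //;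
  case: j => [[|[|[|[|]]]] hj] //=; try exact: h0; try exact: hF; try exact: h7;
  try exact: h11; exact: (pdsmoothN oM).
Qed.

Lemma frame_span_nabla (c : 'I_4 -> Pt R -> R) e : (forall j, pdsmooth M (c j)) ->
  frame_span (nabla G e (fun x => \sum_j c j x *: Fr j x)).
Proof.
move=> hc; exists (fun j x => 'D_(e_ e) (c j) x +
  \sum_(i < 4) c i x * lam e (kf^~ x) (af x) (qf x) (wf x) i j); split=> [j|x Mx].
  apply: (pdsmoothD oM); first exact: pdsmooth_derive.
  by apply: (pdsmooth_sum oM) => i; apply: (pdsmoothM oM) => //; exact: pdsmooth_lam.
have hd j := pdsmooth_is_derive e (hc j) Mx.
rewrite nabla_sum; last first.
  move=> m i j; have h0 := is_derive_Fr m i j Mx (derivable_nuf e Mx).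
  by case: (is_derive_mul (hd m) h0) => h _; under eq_fun do rewrite mxE.
under eq_bigr => j _.
  rewrite nabla_scale; [|by case: (hd j)|by move=> *; exact: derivable_Fr].
  rewrite nabla_FrE // scaler_sumr; over.
rewrite big_split /= exchange_big -big_split /=; apply: eq_bigr => j _.
rewrite scalerDl scaler_suml; congr (_ + _); apply: eq_bigr => i _.
by rewrite scalerA.
Qed.

(** A bracket of two horizontal fields is a curvature operator; every deeper one is a covariant
    derivative of a field already in the span of the frame. *)
Lemma iterated_bracketP X : iterated_bracket G X ->
  (exists e, X = delta G e) \/
  exists B, frame_span B /\ forall p, M p.1 -> X p = linv B p.
Proof.
elim=> [e|e Y _ [[e' ->]|[B [[c [hc hB]] hY]]]]; [by left; exists e | right ..].
  exists (curv G e e'); split; first exact: frame_span_curv.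
  by move=> p; exact: lie_delta2.
exists (nabla G e (fun x => \sum_j c j x *: Fr j x)); split; first exact: frame_span_nabla.
move=> p Mp;
have -> : lie (delta G e) Y p = lie (delta G e) (linv (fun x => \sum_j c j x *: Fr j x)) p.
  by apply: lie_ext => // q Mq; rewrite hY // /linv hB.
apply: lie_delta_linv => i j; under eq_fun do rewrite summxE.
have h m : derivable (fun z => (c m z *: Fr m z) i j) p.1 (e_ e).
  have h0 := is_derive_Fr m i j Mp (derivable_nuf e Mp).
  have hd := pdsmooth_is_derive e (hc m) Mp.
  by case: (is_derive_mul hd h0) => h _; under eq_fun do rewrite mxE.
by case: (is_derive_sumr (fun m => derivableP (h m))).
Qed.

(** As [F = b (a f7 + f11)] is nonzero, t or r is a direction whose brackets with theta and phi
    produce [N_theta] and [N_phi], with a common nonzero factor. *)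
Lemma f7_or_f11 x : M x -> exists2 e : 'I_4, e = it \/ e = ir &
  exists2 m, m != 0 & curv G e ith x = m *: Fr 1 x /\ curv G e iph x = m *: Fr 2 x.
Proof.
move=> Mx; have := (fFM Mx).1; rewrite /Ff /fdF mulf_eq0 negb_or => /andP[_].
have [->|h7 _] := eqVneq (f7 x) 0.
  rewrite mulr0 add0r => h11; exists ir; [by right | exists (f11 x) => //].
  by split; rewrite curvM // sum4 /= !scale0r !add0r ?addr0.
exists it; [by left | exists (f7 x) => //].
by split; rewrite curvM // sum4 /= !scale0r !add0r ?addr0.
Qed.

(** The form [u] takes the value [u] on the first vector and 0 on the others, which gives [c0 = 0];
    the theta and phi components of the other two are then [b u], each in one vector only. *)
Lemma free_frame (p : TPt R) : A p ->
  free [:: p.2 *m Fr 0 p.1; p.2 *m Fr 1 p.1; p.2 *m Fr 2 p.1].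
Proof.
move=> Ap; have Mp := A_M Ap; have [F0 b0] := fFM Mp.
have u0 : p.2 0 it - af p.1 * p.2 0 ir != 0 := ExpU HL Ap.
apply/(@freeP _ _ 3 [tuple p.2 *m Fr 0 p.1; p.2 *m Fr 1 p.1; p.2 *m Fr 2 p.1]) => c.
rewrite !big_ord_recl big_ord0 /= => /rowP h.
have := h iph; have := h ith; have := h ir; have := h it; rewrite !mxE !sum4 !mxE /=.
set c0 := c ord0; set c1 := c _; set c2 := c _.
move: (af p.1) (bf p.1) (nuf p.1) (qf p.1) (p.2 0 it) (p.2 0 ir) (p.2 0 ith) (p.2 0 iph)
  b0 u0 => a b nu q yt yr yh yf b0 u0 ht hr hh hf.
have bu0 : b * (yt - a * yr) != 0 by rewrite mulf_neq0.
have z0 : c0 = 0.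
  have har := congr1 ( *%R a) hr.
  have : c0 * (yt - a * yr) = 0 by lra.
  by move/eqP; rewrite mulf_eq0 (negbTE u0) orbF => /eqP.
have z1 : c1 = 0.
  have : c1 * (b * (yt - a * yr)) = 0 by move: hh; rewrite z0 => hh; lra.
  by move/eqP; rewrite mulf_eq0 (negbTE bu0) orbF => /eqP.
have z2 : c2 = 0.
  have : c2 * (b * (yt - a * yr)) = 0 by move: hf; rewrite z0 => hf; lra.
  by move/eqP; rewrite mulf_eq0 (negbTE bu0) orbF => /eqP.
by move=> i; case: (unliftP ord0 i) => [j|] ->; [|exact: z0];
  case: (unliftP ord0 j) => [l|] ->; [rewrite (ord1 l); exact: z2 | exact: z1].
Qed.

(** The coefficients are chosen to match the theta and phi components; the multiples of [X] in
    [N_theta] and [N_phi] then cancel. *)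
Lemma rotation_span (p : TPt R) : A p ->
  p.2 *m Fr 3 p.1 \in <<[:: p.2 *m Fr 0 p.1; p.2 *m Fr 1 p.1; p.2 *m Fr 2 p.1]>>%VS.
Proof.
move=> Ap; have Mp := A_M Ap; have [F0 b0] := fFM Mp.
have u0 : p.2 0 it - af p.1 * p.2 0 ir != 0 := ExpU HL Ap.
set d := bf p.1 * (p.2 0 it - af p.1 * p.2 0 ir).
have -> : p.2 *m Fr 3 p.1 = (qf p.1 * p.2 0 iph / d) *: (p.2 *m Fr 1 p.1)
    - (p.2 0 ith / d) *: (p.2 *m Fr 2 p.1).
  apply/rowP => j; rewrite !mxE !sum4 !mxE /d.
  by case: j => [[|[|[|[|]]]] hj] //=; field; rewrite u0 b0.
by rewrite rpredB // rpredZ // memv_span // !inE eqxx ?orbT.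
Qed.

Lemma vert_D_H_dim (p : TPt R) : A p -> has_dim (vert_D_H G p) 3.
Proof.
move=> Ap; have Mp := A_M Ap; have [F0 b0] := fFM Mp.
pose S := [tuple p.2 *m Fr 0 p.1; p.2 *m Fr 1 p.1; p.2 *m Fr 2 p.1].
exists <<S>>%VS; split; last exact: eqP (free_frame Ap).
apply/seteqP; split=> [z [n [c [X [hX]]]]|z /= zS].
  have p1 : (\sum_i c i *: X i p).1 = \sum_i c i *: (X i p).1 by exact: big_morph.
  have p2 : (\sum_i c i *: X i p).2 = \sum_i c i *: (X i p).2 by exact: big_morph.
  move=> zE; have z1 : 0 = \sum_i c i *: (X i p).1 by rewrite -p1 -zE.
  have {zE}z2 : z = \sum_i c i *: (X i p).2 by rewrite -p2 -zE.
  pose v := conn_mx G ^~ p.1.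
  (* Each field is replaced by its vertical part relative to the horizontal fields. The sum is
     unchanged because its horizontal components add up to zero, and the summands from [delta]
     become zero. *)
  have -> : z = \sum_i c i *: ((X i p).2 + \sum_a (X i p).1 0 a *: (p.2 *m v a)).
    under eq_bigr do rewrite scalerDr scaler_sumr.
    rewrite big_split /= -z2 exchange_big /= big1 ?addr0 // => a _.
    under eq_bigr do rewrite scalerA.
    rewrite -scaler_suml (_ : \sum_i _ = 0) ?scale0r //.
    move/rowP: z1 => /(_ a); rewrite mxE summxE => z1.
    by rewrite [RHS]z1; apply: eq_bigr => i _; rewrite mxE.
  apply: rpred_sum => i _; apply: rpredZ.
  have [[e ->]|[B [[d [_ hB]] ->//]]] := iterated_bracketP (hX i).
    rewrite deltaE /= (bigD1 e) //= big1 => [|a ae].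
      by rewrite mxE !eqxx scale1r addr0 addNr mem0v.
    by rewrite mxE eqxx (negbTE ae) scale0r.
  rewrite /= big1 ?addr0 => [|a _]; last by rewrite mxE scale0r.
  rewrite hB // mulmx_sumr; apply: rpred_sum => j _; rewrite -scalemxAr; apply: rpredZ.
  case: j => [[|[|[|[|]]]] hj] //=; last exact: rotation_span.
  - by rewrite memv_span // !inE eqxx.
  - by rewrite memv_span // !inE eqxx orbT.
  - by rewrite memv_span // !inE eqxx !orbT.
rewrite (coord_span zS) !big_ord_recl big_ord0 /= addr0.
(* Conversely, the three generators are the brackets of t with r and of [e] with theta and phi,
   divided by their factors [- F], [m] and [m]. *)
have [e he [m m0 [h1 h2]]] := f7_or_f11 Mp.
move: (coord S _ z) (coord S _ z) (coord S _ z) => k2 k1 k0.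
exists 3%N, (fun i : 'I_3 => match val i with
  0%N => - k0 / Ff p.1 | 1%N => k1 / m | _ => k2 / m end).
exists (fun i : 'I_3 => match val i with 0%N => lie (delta G it) (delta G ir)
  | 1%N => lie (delta G e) (delta G ith) | _ => lie (delta G e) (delta G iph) end).
split=> [i|].
  by case: i => [[|[|[|]]] hi] //=; apply: BracketS; exact: Bracket0.
rewrite !big_ord_recl big_ord0 /= lie_tr // !lie_delta2 // /linv h1 h2.
rewrite -!scalemxAr; congr (_, _) => /=; first by rewrite !scaler0 !addr0.
by rewrite !addr0 !scalerA mulrN !divfK // opprK.
Qed.

Lemma not_affinely_equivalent A' L' : pseudo_riemannian M A' L' ->
  ~ affinely_equivalent M A L A' L'.
Proof.
move=> [fL' [g hg]] [G' [cG' [_ _ spray']]].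
(* The connection shared by the two metrics coincides on [M] with the spherical one, whose curvature
   is known. *)
have GG' := canonical_connection_unique cG' (ExpConn HL).
have [x Mx] : M !=set0 by case: HM.
have sG c a b z : M z -> G c a b z = G c b a z.
  by move=> Mz; case: (ExpConn HL) => _ [_ +] _; exact.
have spG p : A' p -> forall c,
    2 * spray L' c p = \sum_a \sum_b G c a b p.1 * p.2 0 a * p.2 0 b.
  move=> Ap c; rewrite spray' //; apply: eq_bigr => a _; apply: eq_bigr => b _.
  by rewrite GG' //; case: fL' => -[_ /(_ _ Ap)[]].
have dG c a b e z : M z -> derivable (G c a b) z (e_ e) by exact: derivable_conn.
have := curv_metric2 oM fL' hg sG dG spG it ir Mx.
have Su := metric2_unit fL' hg Mx.
have Ssym a b : @metric2 R g x a b = @metric2 R g x b a by rewrite !mxE addrC.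
have -> : curv G it ir x = - Ff x *: Fr 0 x.
  by rewrite curvM // sum4 /= !scale0r !addr0.
have F0 : - Ff x != 0 by rewrite oppr_eq0; case: (fFM Mx).
by move/(scaling_degenerate F0 Ssym); rewrite Su.
Qed.

End ExponentialLaw.

Theorem lemma10 (R : realType) (M : set (Pt R)) (A : set (TPt R))
    (L : TPt R -> R) (k : nat -> fun2 R) (phi : fun2 R)
    (HM : spherical_domain M)
    (HL : exponential_law_berwald M A L k phi) :
  (forall (A' : set (TPt R)) (L' : TPt R -> R),
     pseudo_riemannian M A' L' -> ~ affinely_equivalent M A L A' L') /\
  (forall p : TPt R, A p -> has_dim (vert_D_H (sph_connection k) p) 3) /\
  ~ szabo_extension_at M A L.
Proof.
have nm : forall A' L', pseudo_riemannian M A' L' -> ~ affinely_equivalent M A L A' L'.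
  exact: (not_affinely_equivalent HM HL).
split; first exact: nm.
split; first exact: (vert_D_H_dim HM HL).
move=> szabo; have [|A' [L' [pr ae]]] := szabo; last exact: (nm A' L' pr ae).
by exists (sph_connection k); exact: ExpConn HL.
Qed.
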